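(* Let $n\ge1$. We have the expansions $$k_{n/2}(Z-W)=\sum_{l,\mu,\nu}F^{(n)}_{l,\mu,\nu}(W)\cdot G'^{(n)}_{l,\mu,\nu}(Z)=\sum_{l,\mu,\nu}F'^{(n)}_{l,\mu,\nu}(Z)\cdot G^{(n)}_{l,\mu,\nu}(W),$$ which converge uniformly on compact subsets of the region $\{(Z,W)\in\mathbb H_{\mathbb C}^\times\times\mathbb H_{\mathbb C};\ WZ^{-1}\in\mathbb D^+\}$. The sums are taken first over all $\mu=-l-\frac n2,-l-\frac n2+1,\dots,l+\frac n2$ and $\nu=-l,-l+1,\dots,l$, then over $l=0,\frac12,1,\frac32,\dots$.
   Context: $\mathbb H_{\mathbb C}=\mathbb C\otimes_{\mathbb R}\mathbb H$ (complexified quaternions) is identified with complex $2\times2$ matrices $Z=\begin{pmatrix} z_{11} & z_{12} \\ z_{21} & z_{22} \end{pmatrix}$; $N(Z)=\det Z$; $\mathbb H_{\mathbb C}^\times=\{N(Z)\ne0\}$; $\mathbb D^+=\{Z\in\mathbb H_{\mathbb C};\ 1-ZZ^*\text{ is positive definite}\}$ with $Z^*$ the matrix adjoint. $\partial_{ij}=\partial/\partial z_{ij}$ and $\partial=\begin{pmatrix} \partial_{11} & \partial_{21} \\ \partial_{12} & \partial_{22} \end{pmatrix}$. The $n$-fold tensor product $\mathbb H_{\mathbb C}^{\otimes n}$ is identified with complex $2^n\times2^n$ matrices by the Kronecker product. The kernel is $k_{n/2}(Z-W)=(\partial_W\otimes\cdots\otimes\partial_W)\frac1{N(Z-W)}$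 ($n$ factors, derivatives in $W$), with values in $\mathbb H_{\mathbb C}^{\otimes n}$. $\mathbb S$, $\mathbb S'$ are the spaces of columns and rows $\mathbb C^2$; $n$-tensors are columns (rows) of length $2^n$, with entries indexed by $(i_1,\dots,i_n)\in\{1,2\}^n$; a column times a row is a $2^n\times2^n$ matrix. For $l\in\{0,\frac12,1,\dots\}$, $\mu,\nu\in\mathbb Z+l$, $-l\le\mu,\nu\le l$, $t^l_{\nu\,\underline\mu}(Z)$ is the polynomial $$t^l_{\nu\,\underline\mu}(Z)=\frac1{2\pi i}\oint(sz_{11}+z_{21})^{l-\mu}(sz_{12}+z_{22})^{l+\mu}s^{-l+\nu}\,\frac{ds}s$$ (loop once counterclockwise around $0$). For $l=0,\frac12,1,\dots$, $\mu\in\mathbb Z+l+\frac n2$, $-l-\frac n2\le\mu\le l+\frac n2$, $\nu\in\mathbb Z+l$, $-l\le\nu\le l$, define $$F^{(n)}_{l,\mu,\nu}(Z)=\begin{pmatrix} \partial_{11} \\ \partial_{12} \end{pmatrix}^{\otimes n}t^{l+n/2}_{\nu-n/2\,\underline\mu}(Z),\qquad G^{(n)}_{l,\mu,\nu}(Z)=\frac{(l-\nu)!}{(l-\nu+n)!}(\partial_{11},\partial_{21})^{\otimes n}\,t^{l+n/2}_{\mu\,\underline{\nu-n/2}}(Z).$$ $F'^{(n)}_{l,\mu,\nu}$ (column) and $G'^{(n)}_{l,\mu,\nu}$ (row) are the functions on $\mathbb H_{\mathbb C}^\times$ whose entry at $(i_1,\dots,i_n)$, with $p$ indices equal to $1$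 and $q=n-p$ indices equal to $2$, is respectively $$\frac{(l-\nu+p)!}{(l-\nu)!}\frac{(l+\nu+q)!}{(l+\nu)!}\,N(Z)^{-1}t^{l+n/2}_{\nu+(q-p)/2\,\underline\mu}(Z^{-1}),\qquad N(Z)^{-1}t^{l+n/2}_{\mu\,\underline{\nu+(q-p)/2}}(Z^{-1}).$$ (When $-l\le\mu+\frac n2\le l$ these equal $(-1)^n\begin{pmatrix} \partial_{11} \\ \partial_{12} \end{pmatrix}^{\otimes n}\bigl(N(Z)^{-1}t^l_{\nu\,\underline{\mu+n/2}}(Z^{-1})\bigr)$ and $(-1)^n\frac{(l-\mu-n/2)!}{(l-\mu+n/2)!}(\partial_{11},\partial_{21})^{\otimes n}\bigl(N(Z)^{-1}t^l_{\mu+n/2\,\underline\nu}(Z^{-1})\bigr)$.) *)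

(* Defs.v *)
From HB Require Import structures.
From mathcomp Require Import all_boot all_order all_algebra.
From mathcomp Require Import complex mxtens.
From mathcomp Require Import all_classical all_reals all_analysis.
Set Implicit Arguments.
Unset Strict Implicit.
Unset Printing Implicit Defensive.
Import Order.TTheory GRing.Theory Num.Theory.
Import numFieldNormedType.Exports.
Local Open Scope classical_set_scope.
Local Open Scope complex_scope.
Local Open Scope sesquilinear_scope.
Local Open Scope ring_scope.

(* R[i], presented as a numClosedFieldType so that the topology and the
   normed-module structure of a numFieldType are inferred on it; derivatives
   ['D_v] over [CC R] are then complex derivatives. *)
Definition CC (R : realType) : numClosedFieldType := R[i].

(* Complexified quaternions: [Z 0 0], [Z 0 1], [Z 1 0], [Z 1 1] are
   z_11, z_12, z_21, z_22. *)
Definition HC (R : realType) := 'M[CC R]_2.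

Section Domains.
Variable R : realType.

(* [<] on [CC R] also asserts that the right-hand side is real. *)
Definition posdefmx m (A : 'M[CC R]_m) : Prop :=
  forall v : 'cV[CC R]_m, v != 0 -> 0 < (v ^t* *m A *m v) 0 0.

Definition Dplus : set (HC R) := [set Z | posdefmx (1 - Z *m Z ^t*)].

Definition region : set (HC R * HC R) :=
  [set ZW | \det ZW.1 != 0 /\ Dplus (ZW.2 *m ZW.1^-1)].

End Domains.
Arguments region : clear implicits.

Section Contour.
Variable R : realType.

Definition Cintegral (a b : R) (f : R -> CC R) : CC R :=
  (\int[lebesgue_measure]_(x in `[a, b]) complex.Re (f x)) +i*
  (\int[lebesgue_measure]_(x in `[a, b]) complex.Im (f x)).

Definition cis (x : R) : CC R := cos x +i* sin x.

(* The integral of g(s) ds over the unit circle s = cis x, 0 <= x <= 2 pi,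
   for which ds = i cis x dx. *)
Definition circle_integral (g : CC R -> CC R) : CC R :=
  Cintegral 0 (2 * pi) (fun x => g (cis x) * ('i * cis x)).

End Contour.

(* The indices l, mu, nu are half-integers, represented in rat. *)
Definition halfn (n : nat) : rat := n%:R / 2.

Section MatrixCoefficients.
Variable R : realType.

(* For admissible indices l - mu, l + mu are naturals and -l + nu is an
   integer, so that [truncn] and [floor] only change their type. *)
Definition tcoef (l nu mu : rat) (Z : HC R) : CC R :=
  (2 * ((pi : R)%:C : CC R) * 'i)^-1 *
  circle_integral (fun s : CC R =>
    (s * Z 0 0 + Z 1 0) ^+ Num.truncn (l - mu) *
    (s * Z 0 1 + Z 1 1) ^+ Num.truncn (l + mu) *
    s ^ Num.floor (- l + nu) / s).

End MatrixCoefficients.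

(* The position I < 2^n in a Kronecker product stands for the multi-index
   (I_1, ..., I_n) of its n binary digits, most significant first, the values
   0, 1 : 'I_2 standing for the indices 1, 2; see [ntensmx_tdigit]. *)
Definition tdigit n (I : 'I_(2 ^ n)) (k : 'I_n) : 'I_2 :=
  inord ((I %/ 2 ^ (n - k.+1)) %% 2).

Lemma ntensmx_tdigit (K : comPzRingType) (A : 'M[K]_2) n
    (I J : 'I_(2 ^ n.+1)) :
  ntensmx A n.+1 I J = \prod_(k < n.+1) A (tdigit I k) (tdigit J k).
Proof.
have digit0 m (L : 'I_(2 ^ m.+2)) :
    (mxtens_unindex (L : 'I_(2 * 2 ^ m.+1))).1 = tdigit L ord0.
  apply: val_inj; rewrite /= inordK ?ltn_mod// subn1 modn_small//.
  by rewrite ltn_divLR ?expn_gt0// -expnS.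
have digitS m (L : 'I_(2 ^ m.+2)) (k : 'I_m.+1) :
    tdigit (mxtens_unindex (L : 'I_(2 * 2 ^ m.+1))).2 k =
    tdigit L (lift ord0 k).
  congr inord; rewrite /= /bump leq0n add1n subSS.
  have E : (2 ^ m.+1 = 2 ^ k.+1 * 2 ^ (m - k))%N.
    by rewrite -expnD -subSS subnKC.
  rewrite !subSS; move: (L : nat) => {}L.
  by rewrite E -modn_divl modn_dvdm// expnS dvdn_mulr.
rewrite /ntensmx; elim: n I J => [|n IH] I J.
  rewrite big_ord1 /=; congr (A _ _); apply: val_inj;
    by rewrite /= inordK ?ltn_mod// expn0 divn1 modn_small.
rewrite big_ord_recl /= mxE IH !digit0; congr (A _ _ * _).
by apply: eq_bigr => k _; rewrite !digitS.
Qed.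

Section Expansions.
Variable R : realType.

Definition iter_derive (vs : seq (HC R)) (f : HC R -> CC R) : HC R -> CC R :=
  foldr (fun v g Z => 'D_v g Z) f vs.

(* The (i, j) entry of the matrix of operators is the derivative in z_ji; its
   first column gives [colF] and its first row gives [rowG]. *)
Definition ker_half n (Z W : HC R) : 'M[CC R]_(2 ^ n) :=
  \matrix_(I, J)
    iter_derive [seq delta_mx (tdigit J k) (tdigit I k) | k : 'I_n]
      (fun W' => (\det (Z - W'))^-1) W.

Definition colF n (l mu nu : rat) (W : HC R) : 'cV[CC R]_(2 ^ n) :=
  \col_I iter_derive [seq delta_mx 0 (tdigit I k) | k : 'I_n]
    (tcoef (l + halfn n) (nu - halfn n) mu) W.

Definition rowG n (l mu nu : rat) (W : HC R) : 'rV[CC R]_(2 ^ n) :=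
  \row_J (((Num.truncn (l - nu))`!)%:R / ((Num.truncn (l - nu) + n)`!)%:R *
    iter_derive [seq delta_mx (tdigit J k) 0 | k : 'I_n]
      (tcoef (l + halfn n) mu (nu - halfn n)) W).

(* p and q: the numbers of indices of I equal to 1 and to 2. *)
Definition nb1 n (I : 'I_(2 ^ n)) : nat := #|[set k | tdigit I k == 0]|.
Definition nb2 n (I : 'I_(2 ^ n)) : nat := n - nb1 I.

Definition colF' n (l mu nu : rat) (Z : HC R) : 'cV[CC R]_(2 ^ n) :=
  \col_I (((Num.truncn (l - nu) + nb1 I)`!)%:R / ((Num.truncn (l - nu))`!)%:R *
          (((Num.truncn (l + nu) + nb2 I)`!)%:R / ((Num.truncn (l + nu))`!)%:R) *
          (\det Z)^-1 *
          tcoef (l + halfn n) (nu + (halfn (nb2 I) - halfn (nb1 I))) mu Z^-1).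

Definition rowG' n (l mu nu : rat) (Z : HC R) : 'rV[CC R]_(2 ^ n) :=
  \row_J ((\det Z)^-1 *
          tcoef (l + halfn n) mu (nu + (halfn (nb2 J) - halfn (nb1 J))) Z^-1).

(* The sum over 2l = 0, ..., N - 1, then mu = - l - n/2 + i for
   0 <= i <= 2l + n and nu = - l + j for 0 <= j <= 2l. *)
Definition partial_sum n (a : rat -> rat -> rat -> 'M[CC R]_(2 ^ n)) (N : nat) :
    'M[CC R]_(2 ^ n) :=
  \sum_(L < N) \sum_(i < (L + n).+1) \sum_(j < L.+1)
    a (halfn L) (- halfn L - halfn n + i%:R) (- halfn L + j%:R).

End Expansions.

(* Main.v *)
Require Import Defs.
From HB Require Import structures.
From mathcomp Require Import all_boot all_order all_algebra.
From mathcomp Require Import complex.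
From mathcomp Require Import all_classical all_reals all_analysis.
From mathcomp Require Import ring lra zify.
Set Implicit Arguments.
Unset Strict Implicit.
Unset Printing Implicit Defensive.
Import Order.TTheory GRing.Theory Num.Theory.
Import numFieldNormedType.Exports.
Local Open Scope classical_set_scope.
Local Open Scope complex_scope.
Local Open Scope sesquilinear_scope.
Local Open Scope ring_scope.

(* The trace of the D-th symmetric power of X is the complete homogeneous
   symmetric polynomial h_D of the eigenvalues of X; summing over D gives
   1 / N(Z - W) = N(Z)^-1 sum_D tr Sym^D(W Z^-1). As Sym^D is multiplicative, the
   trace is a sum of products of matrix coefficients of W and of Z^-1, and
   applying the n-fold derivative in W to the term D = 2l + n yields the l-th
   term of either expansion, by two different reindexings. For the convergence,
   the remainder after M terms is u_M / N(Z - W) with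
   u_M = h_M - N(W Z^-1) h_(M-1), a polynomial in W. Near the compact set the
   eigenvalues of W Z^-1 stay in a fixed disc of radius < 1, so u_M decays
   geometrically; Cauchy's estimate transfers this to the derivatives of u_M, and
   the quotient rule to those of the remainder. *)

(** * Symmetric powers *)

Section SymmetricPower.
Variable C : comNzRingType.
Implicit Types Z W : 'M[C]_2.

(** Everything is arranged so that only polynomials in W are estimated. The remainder is not one,
    but its numerator over det(Z - W) is, and on a line W + z v a polynomial function becomes a
    polynomial in z whose linear coefficient is the directional derivative. One contour integral
    then serves twice: it identifies t^l with an entry of Sym^(2l), and it bounds that linear
    coefficient. Such a bound at W uses values around W, so the estimates are made on K thickened in
    W by a small polydisc, whose radius is halved at each derivative. The eigenvalues of W Z^-1
    admit no continuous labelling in general, so uniformity over K is drawn from their sum and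
    product, which are rational in det Z, det W and det(Z - W). The domain D^+ enters through the
    spectral radius, which it forces below 1 at each point of K. *)

Definition sympoly b c Z : {poly C} :=
  ('X * (Z 0 0)%:P + (Z 1 0)%:P) ^+ b * ('X * (Z 0 1)%:P + (Z 1 1)%:P) ^+ c.

(* The entry (a, b) is t^l_(nu mu)(Z) for D = 2l, a = l - nu and b = l - mu. *)
Definition sympow D Z : 'M[C]_D.+1 :=
  \matrix_(a, b) (sympoly b (D - b) Z)`_a.

Lemma mulmx2E Z W i j : (Z *m W) i j = Z i 0 * W 0 j + Z i 1 * W 1 j.
Proof.
rewrite mxE big_ord_recl big_ord1.
by congr (_ + Z i _ * W _ j); exact: val_inj.
Qed.

Lemma size_linear_expr (x y : C) n :
  (size (('X * x%:P + y%:P : {poly C}) ^+ n)%R <= n.+1)%N.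
Proof.
have h : (size ('X * x%:P + y%:P : {poly C})%R <= 2)%N.
  apply: (leq_trans (size_polyD _ _)); rewrite geq_max; apply/andP; split.
    by apply: (leq_trans (size_polyMleq _ _));
      rewrite size_polyX size_polyC; case: (x != 0).
  by rewrite size_polyC; case: (y != 0).
apply: (leq_trans (size_poly_exp_leq _ _)).
rewrite ltnS -[X in (_ <= X)%N]mul1n leq_mul2r; apply/orP; right.
by move: h; case: (size _).
Qed.

Lemma size_sympoly b c Z : (size (sympoly b c Z) <= (b + c).+1)%N.
Proof.
apply: (leq_trans (size_polyMleq _ _)).
have := size_linear_expr (Z 0 0) (Z 1 0) b.
have := size_linear_expr (Z 0 1) (Z 1 1) c.
lia.
Qed.

Lemma sympoly_coef0 b c Z a : (b + c < a)%N -> (sympoly b c Z)`_a = 0.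
Proof. by move=> h; apply: nth_default; exact: leq_trans (size_sympoly _ _ _) h. Qed.

(* The value at (u, v) of the binary form of degree d with dehomogenisation p. *)
Definition homog d (p u v : {poly C}) : {poly C} :=
  \sum_(b < d.+1) (p`_b)%:P * u ^+ b * v ^+ (d - b).

Lemma homogX d (p u v : {poly C}) (x y : C) : (size p <= d.+1)%N ->
  homog d.+1 (('X * x%:P + y%:P) * p) u v = (u * x%:P + v * y%:P) * homog d p u v.
Proof.
move=> sp.
have -> : homog d.+1 (('X * x%:P + y%:P) * p) u v =
  x%:P * homog d.+1 ('X * p) u v + y%:P * homog d.+1 p u v.
  rewrite /homog !big_distrr -big_split /=; apply: eq_bigr => b _.
  have -> : (('X * x%:P + y%:P) * p)`_b = x * ('X * p)`_b + y * p`_b.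
    by rewrite mulrDl coefD coefCM mulrAC coefMC [_ * x]mulrC.
  by rewrite polyCD !polyCM; ring.
have -> : homog d.+1 ('X * p) u v = u * homog d p u v.
  rewrite /homog big_ord_recl /= coefXM eqxx !mul0r add0r big_distrr /=.
  by apply: eq_bigr => b _; rewrite /bump /= add1n subSS coefXM /= exprS; ring.
have -> : homog d.+1 p u v = v * homog d p u v.
  rewrite /homog big_ord_recr /= (nth_default _ sp) !mul0r addr0 big_distrr /=.
  by apply: eq_bigr => b _; rewrite subSn -1?ltnS// exprS; ring.
by ring.
Qed.

(** The columns of [Z *m W] are combinations of those of Z with coefficients from W. The binary form
    attached to W is thus evaluated at the two linear forms of Z, which is the functoriality of the
    symmetric power. *)
Lemma sympolyM b c Z W :
  sympoly b c (Z *m W) =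
  homog (b + c) (sympoly b c W) ('X * (Z 0 0)%:P + (Z 1 0)%:P)
    ('X * (Z 0 1)%:P + (Z 1 1)%:P).
Proof.
set u := 'X * _ + _; set v := (X in homog _ _ _ X).
have linE i : 'X * ((Z *m W) 0 i)%:P + ((Z *m W) 1 i)%:P
    = u * (W 0 i)%:P + v * (W 1 i)%:P.
  by rewrite !mulmx2E !(polyCD, polyCM) /u /v; ring.
rewrite /sympoly !linE; elim: b => [|b IH].
  rewrite !expr0 !mul1r add0n; elim: c => [|c IH].
    by rewrite /homog big_ord1 !expr0 coef1 eqxx !mulr1.
  have := size_sympoly 0 c W; rewrite /sympoly expr0 mul1r add0n => sc.
  by rewrite exprS IH [in RHS]exprS homogX.
rewrite exprS -mulrA IH [in RHS]exprS -[in RHS]mulrA addSn homogX//.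
exact: size_sympoly.
Qed.

Lemma sympowM D Z W : sympow D (Z *m W) = sympow D Z *m sympow D W.
Proof.
apply/matrixP => a c; rewrite !mxE sympolyM subnKC -1?ltnS//.
rewrite /homog coef_sum; apply: eq_bigr => b _.
by rewrite !mxE -mulrA coefCM mulrC.
Qed.

Lemma coef_linear_exp (x y : C) n : ((('X * x%:P + y%:P : {poly C}) ^+ n)`_n) = x ^+ n.
Proof.
elim: n => [|n IH]; first by rewrite !expr0 coef1.
rewrite exprS mulrDl coefD coefCM (nth_default _ (size_linear_expr _ _ _)).
by rewrite mulr0 addr0 -mulrA coefXM /= coefCM IH exprS.
Qed.

(** The second factor of [sympoly] is then constant, so only the top coefficient of the first one
    contributes. *)
Lemma sympow_trig_diag D Z (a : 'I_D.+1) : Z 0 1 = 0 ->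
  sympow D Z a a = Z 0 0 ^+ a * Z 1 1 ^+ (D - a).
Proof.
move=> Z01; rewrite mxE /sympoly Z01 mulr0 add0r -rmorphXn coefMC.
by rewrite coef_linear_exp.
Qed.

Lemma sympow1 D : sympow D 1 = 1.
Proof.
apply/matrixP => a b; rewrite !mxE /sympoly !mxE /= mulr1 !mulr0 add0r addr0.
by rewrite expr1n mulr1 coefXn.
Qed.

(* For eigenvalues x and y this is the trace of sympow D, a complete homogeneous
   symmetric polynomial. *)
Definition hsym D (x y : C) := \sum_(a < D.+1) x ^+ a * y ^+ (D - a).

Lemma hsymS D x y : hsym D.+1 x y = x ^+ D.+1 + y * hsym D x y.
Proof.
rewrite /hsym big_ord_recr /= subnn mulr1 addrC big_distrr /=; congr (_ + _).
by apply: eq_bigr => a _; rewrite subSn -1?ltnS// exprS; ring.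
Qed.

(** A truncation of the generating series of the h_D, which is 1 / ((1 - x) (1 - y)). *)
Lemma hsym_sum M x y :
  (1 - x) * (1 - y) * \sum_(D < M.+1) hsym D x y =
  1 - (hsym M.+1 x y - x * y * hsym M x y).
Proof.
elim: M => [|M IH].
  by rewrite big_ord1 /hsym !big_ord_recl !big_ord0 /= !subnn; ring.
(* The linear recurrence with characteristic roots x and y. *)
have e : hsym M.+2 x y = (x + y) * hsym M.+1 x y - x * y * hsym M x y.
  by rewrite !hsymS !exprS; ring.
by rewrite big_ord_recr mulrDr IH /= e; ring.
Qed.

End SymmetricPower.

(** * Moduli, geometric decay and stability of roots *)

Section Modulus.
Variable R : realType.
Implicit Types x y : CC R.

(* The norm of CC R takes values in CC R. *)
Definition cabs x : R := complex.Re `|x|.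

Lemma cabsE x : `|x| = (cabs x)%:C :> CC R.
Proof. by rewrite /cabs RRe_real// normr_real. Qed.

Lemma cabs_ge0 x : 0 <= cabs x.
Proof. by rewrite -lecR -cabsE; exact: normr_ge0. Qed.

Lemma cabsM x y : cabs (x * y) = cabs x * cabs y.
Proof. by apply: complexI; rewrite rmorphM -!cabsE normrM. Qed.

Lemma cabsD x y : cabs (x + y) <= cabs x + cabs y.
Proof. by rewrite -lecR rmorphD -!cabsE; exact: ler_normD. Qed.

Lemma cabsN x : cabs (- x) = cabs x.
Proof. by rewrite /cabs normrN. Qed.

Lemma cabsB x y : cabs (x - y) <= cabs x + cabs y.
Proof. by rewrite -[cabs y]cabsN cabsD. Qed.

Lemma cabs0 : cabs 0 = 0.
Proof. by apply: complexI; rewrite -cabsE normr0. Qed.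

Lemma cabs1 : cabs 1 = 1.
Proof. by apply: complexI; rewrite -cabsE normr1. Qed.

Lemma cabsX x n : cabs (x ^+ n) = cabs x ^+ n.
Proof. by apply: complexI; rewrite rmorphXn -!cabsE normrX. Qed.

Lemma cabsV x : cabs x^-1 = (cabs x)^-1.
Proof. by apply: complexI; rewrite fmorphV -!cabsE normfV. Qed.

Lemma cabs_nat n : cabs n%:R = n%:R.
Proof. by apply: complexI; rewrite -cabsE normr_nat rmorph_nat. Qed.

Lemma cabs_gt0 x : (0 < cabs x) = (x != 0).
Proof. by rewrite -ltcR -cabsE; exact: normr_gt0. Qed.

Lemma cabs_sum (I : Type) (s : seq I) (F : I -> CC R) :
  cabs (\sum_(i <- s) F i) <= \sum_(i <- s) cabs (F i).
Proof.
elim/big_rec2 : _ => [|i y1 y2 _ h]; first by rewrite cabs0.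
by apply: (le_trans (cabsD _ _)); rewrite lerD2l.
Qed.

Lemma hsym_le D x y (r : R) : cabs x <= r -> cabs y <= r ->
  cabs (hsym D x y) <= D.+1%:R * r ^+ D.
Proof.
move=> xr yr; apply: (le_trans (cabs_sum _ _)).
rewrite -[X in _ <= X%:R * _]card_ord -sum1_card natr_sum mulr_suml.
apply: ler_sum => a _; rewrite mul1r cabsM !cabsX.
have -> : r ^+ D = r ^+ a * r ^+ (D - a) by rewrite -exprD subnKC// -ltnS.
by apply: ler_pM; rewrite ?exprn_ge0 ?cabs_ge0// lerXn2r// nnegrE
  ?cabs_ge0// (le_trans (cabs_ge0 x)).
Qed.

(** With r = s^2, one factor s^M absorbs the linear factor, since (M + 1) s^M is at most a geometric
    sum and hence at most 1 / (1 - s). The other factor s^M tends to 0. *)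
Lemma nat_geom_cvg0 (r : R) : 0 <= r < 1 -> forall e, 0 < e ->
  exists M0, forall M, (M0 <= M)%N -> M.+2%:R * r ^+ M <= e.
Proof.
move=> /andP[r0 r1] e e0; pose s := Num.sqrt r.
have s0 : 0 <= s by exact: sqrtr_ge0.
have s1 : s < 1 by rewrite -sqrtr1 ltr_sqrt.
have rE : r = s * s by rewrite -expr2 sqr_sqrtr.
have b M : M.+1%:R * s ^+ M * (1 - s) <= 1.
  suff : M.+1%:R * s ^+ M * (1 - s) <= 1 - s ^+ M.+1.
    by move=> h; apply: (le_trans h); rewrite lerBlDr lerDl exprn_ge0.
  elim: M => [|M IH]; first by rewrite expr0 expr1 !mul1r.
  have -> : 1 - s ^+ M.+2 = 1 - s ^+ M.+1 + s ^+ M.+1 * (1 - s).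
    by rewrite [s ^+ M.+2]exprS; ring.
  rewrite -natr1 mulrDl mul1r mulrDl; apply: lerD; last by [].
  apply: le_trans IH; rewrite exprS -!mulrA ler_wpM2l//.
  apply: ler_piMl; last exact: ltW.
  by apply: mulr_ge0; rewrite ?exprn_ge0// subr_ge0 ltW.
have s1' : 0 < 1 - s by rewrite subr_gt0.
have /cvgrPdist_le/(_ (e * (1 - s) / 2)) : (GRing.exp s : R ^nat) @ \oo --> 0.
  by apply: cvg_expr; rewrite ger0_norm.
have e2 : 0 < e * (1 - s) / 2 by rewrite divr_gt0 ?mulr_gt0.
move=> /(_ e2) [M0 _ h]; exists M0 => M /h /=.
rewrite sub0r normrN ger0_norm ?exprn_ge0// => sM.
rewrite rE exprMn -(ler_pM2r s1').
have -> : M.+2%:R * (s ^+ M * s ^+ M) * (1 - s) =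
    (M.+2%:R * s ^+ M * (1 - s)) * s ^+ M by ring.
apply: (@le_trans _ _ (2 * s ^+ M)).
  rewrite ler_wpM2r ?exprn_ge0//.
  apply: (@le_trans _ _ (2%:R * (M.+1%:R * s ^+ M * (1 - s)))).
    have -> : 2%:R * (M.+1%:R * s ^+ M * (1 - s)) =
        (2 * M.+1)%N%:R * (s ^+ M * (1 - s)).
      by rewrite natrM; ring.
    rewrite -mulrA ler_wpM2r//; last by rewrite ler_nat; lia.
    by apply: mulr_ge0; [exact: exprn_ge0 | exact: ltW].
  by rewrite -[leRHS]mulr1 ler_wpM2l.
have : 2 * (e * (1 - s) / 2) = e * (1 - s) by field.
by move=> <-; rewrite ler_pM2l.
Qed.

(** Continuity of roots without any labelling: a root x of the perturbed quadratic nearly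
    annihilates the original one, so it cannot lie far outside the disc of radius m that contains x0
    and y0. *)
Lemma root_stable (x0 y0 : CC R) : cabs x0 < 1 -> cabs y0 < 1 ->
  exists2 r : R, 0 <= r < 1 & exists2 e : R, 0 < e & forall x y : CC R,
    cabs (x + y - (x0 + y0)) < e -> cabs (x * y - x0 * y0) < e -> cabs x <= r.
Proof.
move=> x01 y01; pose m := Num.max (cabs x0) (cabs y0).
have m0 : 0 <= m by rewrite le_max cabs_ge0.
have m1 : m < 1 by rewrite gt_max x01.
exists ((1 + m) / 2); first by apply/andP; split; lra.
(* The gap between m and the midpoint (1 + m) / 2, which is the radius r. *)
pose dl := (1 - m) / 2; have dl0 : 0 < dl by rewrite /dl; lra.
exists (dl ^+ 2 / 4); first by rewrite divr_gt0// exprn_gt0.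
move=> x y ht hd; rewrite leNgt; apply/negP => xr.
have xm z : cabs z <= m -> cabs x - m <= cabs (x - z).
  move=> zm; have := cabsD (x - z) z; rewrite subrK; lra.
have hx0 : cabs x - m <= cabs (x - x0) by apply: xm; rewrite le_max lexx.
have hy0 : cabs x - m <= cabs (x - y0) by apply: xm; rewrite le_max lexx orbT.
(* The quadratic with roots x0 and y0 at x, rewritten by x^2 = (x + y) x - x y. *)
have eq : (x - x0) * (x - y0) = (x + y - (x0 + y0)) * x - (x * y - x0 * y0) by ring.
have h1 : (cabs x - m) ^+ 2 <= cabs (x - x0) * cabs (x - y0).
  rewrite expr2; apply: ler_pM => //; lra.
have h2 : cabs (x - x0) * cabs (x - y0) <= dl ^+ 2 / 4 * (cabs x + 1).
  rewrite -cabsM eq; apply: (le_trans (cabsB _ _)); rewrite cabsM mulrDr mulr1.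
  by apply: lerD; [rewrite ler_wpM2r ?cabs_ge0// ltW | exact: ltW].
move: h1 h2 xr dl0; rewrite /dl; set a := cabs x => h1 h2 xr dl0.
(* This turns the two bounds into (a - m)^2 <= dl / 2 * (a - m), which contradicts a - m > dl. *)
have h3 : (1 - m) / 4 * (a + 1) <= a - m by nra.
nra.
Qed.

End Modulus.

Lemma det_mx2 (C : comNzRingType) (A : 'M[C]_2) :
  \det A = A 0 0 * A 1 1 - A 0 1 * A 1 0.
Proof.
rewrite (expand_det_row _ 0) !big_ord_recl big_ord0 /cofactor !det_mx11 !mxE /=.
rewrite (_ : lift ord0 ord0 = 1 :> 'I_2); last exact: val_inj.
rewrite (_ : lift 1 (0 : 'I_1) = 0 :> 'I_2); last exact: val_inj.
by rewrite addr0 expr0 expr1 mul1r mulN1r mulrN.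
Qed.

Lemma mxtrace2 (C : comNzRingType) (A : 'M[C]_2) : \tr A = A 0 0 + A 1 1.
Proof.
by rewrite /mxtrace !big_ord_recl big_ord0 addr0; congr (_ + A _ _); exact: val_inj.
Qed.

(** * Eigenvalues and the truncated resolvent *)

Section Eigenvalues.
Variable R : realType.
Implicit Types Z W X : HC R.

(** Unitary conjugation preserves the positivity defining D^+. The i-th diagonal entry of 1 - U U^*
    is 1 minus the squared norm of row i of U, so its positivity bounds the entry (i, i) of U. *)
Lemma Dplus_unitary_diag X (P : HC R) i : P \is unitarymx -> Dplus X ->
  cabs ((P *m X *m P ^t*) i i) < 1.
Proof.
move=> Pu XD; have PQ : P *m P ^t* = 1 by apply/unitarymxP.
have QP : P ^t* *m P = 1 by apply: mulmx1C.
pose v : 'cV[CC R]_2 := col i (P ^t*).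
have vE : v ^t* = row i P.
  by apply/matrixP => a b; rewrite !mxE conjCK.
have v0 : v != 0.
  apply/eqP => v0; have : (P *m v) i 0 = 0 by rewrite v0 mulmx0 mxE.
  by rewrite /v colE mulmxA PQ mul1mx !mxE !eqxx => /eqP; rewrite oner_eq0.
have := XD v v0; rewrite vE rowE /v colE.
set U := P *m X *m P ^t*.
have UE : P *m (1 - X *m X ^t*) *m P ^t* = 1 - U *m U ^t*.
  rewrite mulmxBr mulmx1 mulmxBl PQ; congr (_ - _).
  rewrite /U !trmx_mul !map_mxM trmxCK /= !mulmxA.
  by rewrite -[_ *m P ^t* *m P]mulmxA QP mulmx1.
have -> : delta_mx (0 : 'I_1) i *m P *m (1 - X *m X ^t*) *m
    (P ^t* *m delta_mx i (0 : 'I_1))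
   = delta_mx (0 : 'I_1) i *m (1 - U *m U ^t*) *m delta_mx i (0 : 'I_1)
  by rewrite -UE !mulmxA.
rewrite -rowE -colE; clearbody U.
rewrite !mxE eqxx (bigD1 i)//= !mxE -normCK subr_gt0 => h.
have {}h : `|U i i| ^+ 2 < 1.
  apply: le_lt_trans h; rewrite lerDl sumr_ge0// => k _.
  by rewrite !mxE mul_conjC_ge0.
by rewrite -ltcR -cabsE; move: h; rewrite expr_lt1.
Qed.

(** Schur's triangulation is used because its change of basis is unitary: this is what carries the
    condition of D^+ over to the eigenvalues on the diagonal. *)
Lemma spectrum X : exists x y : CC R,
  [/\ \tr X = x + y, \det X = x * y,
      forall D, \tr (sympow D X) = hsym D x y &
      Dplus X -> cabs x < 1 /\ cabs y < 1].
Proof.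
have [P Pu] := @Schur (CC R) 2 X isT.
have PQ : P *m P ^t* = 1 by apply/unitarymxP.
have QP : P ^t* *m P = 1 by apply: mulmx1C.
rewrite /similar_to conjumx ?unitarymx_unit// invmx_unitary//.
set U := P *m X *m P ^t* => /is_trig_mxP/(_ 0 1 isT) U01.
exists (U 0 0), (U 1 1); split.
- by rewrite -mxtrace2 /U mxtrace_mulC mulmxA QP mul1mx.
- have -> : U 0 0 * U 1 1 = \det U by rewrite det_mx2 U01 mul0r subr0.
  by rewrite /U !det_mulmx mulrAC -det_mulmx PQ det1 mul1r.
- move=> D; have -> : \tr (sympow D X) = \tr (sympow D U).
    by rewrite /U !sympowM mxtrace_mulC mulmxA -sympowM QP sympow1 mul1mx.
  by apply: eq_bigr => a _; rewrite sympow_trig_diag.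
- by move=> XD; split; exact: Dplus_unitary_diag.
Qed.

(* The numerator of the remainder of the expansion of 1 / det (Z - W). *)
Definition remnum M Z W : CC R :=
  \tr (sympow M.+1 (W *m Z^-1)) -
  \det (W *m Z^-1) * \tr (sympow M (W *m Z^-1)).

(** After the factorisation Z - W = (1 - W Z^-1) Z, this is [hsym_sum] at the eigenvalues of W
    Z^-1. *)
Lemma resolvent M Z W : \det Z != 0 ->
  \det (Z - W) * ((\det Z)^-1 * \sum_(D < M.+1) \tr (sympow D (W *m Z^-1))) =
  1 - remnum M Z W.
Proof.
move=> Z0; have Zu : Z \in unitmx by rewrite unitmxE unitfE.
have -> : Z - W = (1 - W *m Z^-1) *m Z.
  by rewrite mulmxBl mul1mx mulmxKV.
rewrite det_mulmx -mulrA mulVKf// /remnum.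
set X := W *m Z^-1; have [x [y [tE dE hE _]]] := spectrum X.
have -> : \det (1 - X) = (1 - x) * (1 - y).
  have -> : \det (1 - X) = 1 - \tr X + \det X.
    by rewrite !det_mx2 mxtrace2 !mxE /=; ring.
  by rewrite tE dE; ring.
rewrite dE !hE -hsym_sum; congr (_ * _).
by apply: eq_bigr => D _; rewrite hE.
Qed.

Lemma remnum_le M Z W (r : R) : 0 <= r <= 1 ->
  (forall x y : CC R, \tr (W *m Z^-1) = x + y -> \det (W *m Z^-1) = x * y ->
    cabs x <= r) ->
  cabs (remnum M Z W) <= 2 * (M.+2%:R * r ^+ M).
Proof.
move=> /andP[r0 r1] h; rewrite /remnum.
have [x [y [tE dE hE _]]] := spectrum (W *m Z^-1).
have xr := h _ _ tE dE.
(* The hypothesis covers ordered pairs, so exchanging x and y bounds the other eigenvalue. *)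
have yr : cabs y <= r by apply: (h y x); rewrite 1?[y + x]addrC 1?[y * x]mulrC.
rewrite dE !hE; apply: (le_trans (cabsB _ _)).
rewrite [leRHS]mulr_natl mulr2n; apply: lerD.
  apply: (le_trans (hsym_le _ xr yr)); rewrite ler_wpM2l// exprS.
  by rewrite ler_piMl ?exprn_ge0.
rewrite !cabsM; apply: (@le_trans _ _ (1 * (M.+1%:R * r ^+ M))).
  apply: ler_pM; rewrite ?mulr_ge0 ?cabs_ge0//; last exact: hsym_le.
  by rewrite mulr_ile1 ?cabs_ge0// (le_trans _ r1).
by rewrite mul1r ler_wpM2r ?exprn_ge0// ler_nat.
Qed.

End Eigenvalues.

(** * Contour integrals *)

Section CircleIntegral.
Variable R : realType.
Implicit Types (f F : R -> R) (h : R -> CC R).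

Lemma Rintegral_derive f F (a b : R) : a < b -> continuous f ->
  (forall x : R, is_derive x (1 : R) F (f x)) ->
  (\int[lebesgue_measure]_(x in `[a, b]) f x) = F b - F a.
Proof.
move=> ab cf dF; rewrite /Rintegral (continuous_FTC2 ab (F := F)) //.
- exact: continuous_subspaceT.
- have cF x : {for x, continuous F}.
    by apply/differentiable_continuous/derivable1_diffP; have [] := dF x.
  split.
  + by move=> x _; have [] := dF x.
  + exact/cvg_at_right_filter/cF.
  + exact/cvg_at_left_filter/cF.
- by move=> x _; rewrite derive1E; have [_ ->] := dF x.
Qed.

Lemma continuous_trig (k al be : R) :
  continuous (fun x : R => al * cos (k * x) + be * sin (k * x)).
Proof.
move=> x; apply: cvgD; (apply: cvgM; first exact: cvg_cst);
  [apply: (@continuous_comp _ _ _ (fun y : R => k * y) cos); last exact: continuous_cos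
  |apply: (@continuous_comp _ _ _ (fun y : R => k * y) sin); last exact: continuous_sin];
  by apply: cvgM; [exact: cvg_cst | exact: cvg_id].
Qed.

Lemma continuous_integrable_itv f (a b : R) : continuous f ->
  lebesgue_measure.-integrable `[a, b] (EFin \o f).
Proof.
move=> cf; apply: continuous_compact_integrable; first exact: segment_compact.
exact: continuous_subspaceT.
Qed.

Lemma two_pi_gt0 : (0 : R) < 2 * pi.
Proof. by rewrite mulr_gt0 ?pi_gt0. Qed.

Lemma Rintegral_trig (k al be : R) : k != 0 ->
  cos (k * (2 * pi)) = 1 -> sin (k * (2 * pi)) = 0 ->
  (\int[lebesgue_measure]_(x in `[0, 2 * pi])
    (al * cos (k * x) + be * sin (k * x))) = 0.
Proof.
move=> k0 ck sk.
pose F x := k^-1 * (al * sin (k * x) - be * cos (k * x)).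
have dF (x : R) : is_derive x (1 : R) F (al * cos (k * x) + be * sin (k * x)).
  have d : is_derive x (1 : R) (fun y : R => k * y) k.
    by apply: is_derive_eq; rewrite /GRing.scale/= mulr1.
  have ds : is_derive x (1 : R) (fun y : R => sin (k * y)) (cos (k * x) * k).
    exact: (@is_derive1_comp _ sin (fun y : R => k * y)).
  have dc : is_derive x (1 : R) (fun y : R => cos (k * y)) (- sin (k * x) * k).
    exact: (@is_derive1_comp _ cos (fun y : R => k * y)).
  rewrite /F; apply: is_derive_eq; rewrite /GRing.scale/=.
  by field.
rewrite (Rintegral_derive two_pi_gt0 (@continuous_trig k al be) dF).
by rewrite /F ck sk !mulr0 cos0 sin0 mulr0 subrr.
Qed.

Lemma Rintegral_const (al : R) :
  (\int[lebesgue_measure]_(x in `[0, 2 * pi]) al) = 2 * pi * al.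
Proof.
have dF (x : R) : is_derive x (1 : R) (fun x => al * x) al.
  by apply: is_derive_eq; rewrite /GRing.scale/= mulr1.
rewrite (Rintegral_derive two_pi_gt0 (@cst_continuous R R al) dF).
by rewrite mulr0 subr0 mulrC.
Qed.

(** Continuity is carried along with the value because additivity and the norm bound require
    integrability. *)
Definition has_turn_integral h v :=
  [/\ continuous (fun x => complex.Re (h x)), continuous (fun x => complex.Im (h x)) &
      Cintegral 0 (2 * pi) h = v].

Lemma has_turn_integralD h1 h2 v1 v2 : has_turn_integral h1 v1 ->
  has_turn_integral h2 v2 -> has_turn_integral (fun x => h1 x + h2 x) (v1 + v2).
Proof.
have ReD (x y : CC R) : complex.Re (x + y) = complex.Re x + complex.Re y.
  by case: x; case: y.
have ImD (x y : CC R) : complex.Im (x + y) = complex.Im x + complex.Im y.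
  by case: x; case: y.
move=> [cr1 ci1 <-] [cr2 ci2 <-]; split.
- by move=> x; rewrite (_ : (fun x => _) =
      (fun x => complex.Re (h1 x) + complex.Re (h2 x)));
    [apply: cvgD; [exact: cr1|exact: cr2] | apply/funext => y].
- by move=> x; rewrite (_ : (fun x => _) =
      (fun x => complex.Im (h1 x) + complex.Im (h2 x)));
    [apply: cvgD; [exact: ci1|exact: ci2] | apply/funext => y].
rewrite /Cintegral.
under eq_Rintegral do rewrite ReD.
rewrite RintegralD//; [|exact: continuous_integrable_itv..].
under [X in _ +i* X]eq_Rintegral do rewrite ImD.
by rewrite RintegralD//; exact: continuous_integrable_itv.
Qed.

Lemma has_turn_integral_sum n (h : 'I_n -> R -> CC R) (v : 'I_n -> CC R) :
  (forall i, has_turn_integral (h i) (v i)) ->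
  has_turn_integral (fun x => \sum_i h i x) (\sum_i v i).
Proof.
elim: n h v => [|n IH] h v hv.
  under eq_fun do rewrite big_ord0.
  rewrite big_ord0; split => /=; [exact: cst_continuous | exact: cst_continuous|].
  by rewrite /Cintegral /= Rintegral_const mulr0.
under eq_fun do rewrite big_ord_recl.
by rewrite big_ord_recl; apply: has_turn_integralD => //; apply: IH.
Qed.

Lemma has_turn_integral_cis (c : CC R) (k : R) :
  cos (k * (2 * pi)) = 1 -> sin (k * (2 * pi)) = 0 ->
  has_turn_integral (fun x => c * cis (k * x))
    (if k == 0 then (2 * pi)%:C * c else 0).
Proof.
move=> ck sk; case: c => c1 c2; split => /=.
- rewrite (_ : (fun x => _) = (fun x => c1 * cos (k * x) + (- c2) * sin (k * x))).
    exact: continuous_trig.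
  by apply/funext => x; rewrite mulNr.
- rewrite (_ : (fun x => _) = (fun x => c2 * cos (k * x) + c1 * sin (k * x))).
    exact: continuous_trig.
  by apply/funext => x; rewrite addrC.
rewrite /Cintegral /=.
under eq_Rintegral do rewrite -mulNr.
under [X in _ +i* X]eq_Rintegral do rewrite addrC.
have [->|k0] := eqVneq k 0; last by rewrite !Rintegral_trig.
under eq_Rintegral do rewrite mul0r cos0 sin0 mulr1 mulr0 addr0.
under [X in _ +i* X]eq_Rintegral do rewrite mul0r cos0 sin0 mulr1 mulr0 addr0.
by rewrite !Rintegral_const; apply/eqP; rewrite eq_complex /= !mul0r subr0 addr0 !eqxx.
Qed.

Lemma cisD (x y : R) : cis (x + y) = cis x * cis y.
Proof.
by apply/eqP; rewrite eq_complex /= cosD sinD eqxx /= addrC.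
Qed.

Lemma cis0 : cis 0 = 1 :> CC R.
Proof. by rewrite /cis cos0 sin0. Qed.

Lemma cisMn n (x : R) : cis (n%:R * x) = cis x ^+ n.
Proof.
elim: n => [|n IH]; first by rewrite mul0r cis0.
by rewrite -natr1 mulrDl mul1r cisD IH exprSr.
Qed.

Lemma cis_neq0 (x : R) : cis x != 0.
Proof.
apply/eqP => h; have : cis (x + - x) = 0 by rewrite cisD h mul0r.
by rewrite subrr cis0 => /eqP; rewrite oner_eq0.
Qed.

Lemma cisN (x : R) : cis (- x) = (cis x)^-1.
Proof.
by apply: (mulfI (cis_neq0 x)); rewrite -cisD subrr cis0 mulfV ?cis_neq0.
Qed.

Lemma cis_2pi : cis (2 * pi) = 1 :> CC R.
Proof. by rewrite /cis mulr_natl cos2pi sin2pi. Qed.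

(** Orthogonality of the functions [cis (k * x)] for integral k: only the frequency j - a = 0
    contributes. The index a may exceed the degree. *)
Lemma circle_integral_coef (p : {poly CC R}) a :
  has_turn_integral (fun x => p.[cis x] * cis x ^- a * 'i)
    ((2 * pi)%:C * 'i * p`_a).
Proof.
pose k (j : nat) : R := j%:R - a%:R.
have kE j x : cis (k j * x) = cis x ^+ j * cis x ^- a.
  by rewrite /k mulrBl cisD cisN !cisMn.
have k2 j : cis (k j * (2 * pi)) = 1 by rewrite kE cis_2pi !expr1n mul1r invr1.
have H : has_turn_integral (fun x => \sum_(j < size p) (p`_j * 'i) * cis (k j * x))
    (\sum_(j < size p) (if k j == 0 then (2 * pi)%:C * (p`_j * 'i) else 0)).
  apply: has_turn_integral_sum => j.
  by have := k2 j; rewrite /cis => -[h1 h2]; apply: has_turn_integral_cis.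
rewrite (_ : (fun x => _) =
  (fun x => \sum_(j < size p) (p`_j * 'i) * cis (k j * x))); last first.
  apply/funext => x; rewrite horner_coef !mulr_suml; apply: eq_bigr => j _.
  by rewrite kE; ring.
suff -> : (2 * pi)%:C * 'i * p`_a =
  \sum_(j < size p) (if k j == 0 then (2 * pi)%:C * (p`_j * 'i) else 0) by [].
have kk j : (k j == 0) = (j == a) by rewrite /k subr_eq0 eqr_nat.
have [ap|pa] := ltnP a (size p).
  rewrite (bigD1 (Ordinal ap))//= kk eqxx big1 ?addr0; first by ring.
  by move=> j ja; rewrite kk ifN.
rewrite nth_default// mulr0 big1// => j _; rewrite kk ifN//.
by apply/eqP => ja; have := ltn_ord j; rewrite ja ltnNge pa.
Qed.

Lemma cabs_def (x : CC R) :
  cabs x = Num.sqrt (complex.Re x ^+ 2 + complex.Im x ^+ 2).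
Proof. by apply: complexI; rewrite -cabsE; exact: normc_def. Qed.

(** The real and imaginary parts are bounded separately, whence the factor 2. *)
Lemma has_turn_integral_le h v (B : R) : has_turn_integral h v ->
  (forall x, cabs (h x) <= B) -> cabs v <= 2 * (2 * pi * B).
Proof.
move=> [cr ci <-] hB.
have ReB (z : CC R) : `|complex.Re z| <= cabs z.
  by rewrite -lecR -cabsE; exact: normc_ge_Re.
have ImB (z : CC R) : `|complex.Im z| <= cabs z.
  have -> : complex.Im z = complex.Re (z * - 'i%C).
    by case: z => a b /=; rewrite !(mulr0, mulr1, mulrN, oppr0, sub0r, opprK).
  apply: (le_trans (ReB _)); rewrite cabsM cabsN.
  suff -> : cabs ('i%C : CC R) = 1 by rewrite mulr1.
  by rewrite cabs_def /= expr0n expr1n add0r sqrtr1.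
have bound (f : R -> R) : continuous f -> (forall x, `|f x| <= B) ->
    `|\int[lebesgue_measure]_(x in `[0, 2 * pi]) f x| <= 2 * pi * B.
  move=> cf fB; rewrite -Rintegral_const.
  apply: (le_trans (le_normr_Rintegral _ _)) => //; first exact: continuous_integrable_itv.
  apply: le_Rintegral => //.
  - by apply: continuous_integrable_itv => x; apply: cvg_norm; exact: cf.
  - by apply: continuous_integrable_itv; exact: cst_continuous.
have -> : 2 * (2 * pi * B) = 2 * pi * B + 2 * pi * B by ring.
set z := Cintegral _ _ _.
apply: (@le_trans _ _ (`|complex.Re z| + `|complex.Im z|)).
  have ge0 : 0 <= `|complex.Re z| + `|complex.Im z| by rewrite addr_ge0.
  rewrite cabs_def -(ger0_norm ge0) -(sqrtr_sqr (_ + _)).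
  apply: ler_wsqrtr.
  rewrite sqrrD !real_normK ?num_real// -addrA lerD2l addrC lerDl.
  by rewrite mulrn_wge0// mulr_ge0.
apply: lerD; apply: bound => // x; apply: le_trans (hB x); [exact: ReB | exact: ImB].
Qed.

(** Cauchy's estimate on the circle of radius s, moved to the unit circle by rescaling the
    variable. *)
Lemma coef1_le (p : {poly CC R}) (s B : R) : 0 < s ->
  (forall z : CC R, cabs z <= s -> cabs p.[z] <= B) -> cabs p`_1 <= 2 * B / s.
Proof.
move=> s0 pB; pose q := p \Po (s%:C *: 'X).
have qE x : q.[x] = p.[s%:C * x] by rewrite horner_comp !hornerE.
have q1 : q`_1 = s%:C * p`_1.
  rewrite /q comp_polyE coef_sum (eq_bigr (fun i : 'I_(size p) =>
    p`_i * (s%:C ^+ i * (i == 1%N :> nat)%:R))); last first.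
    by move=> i _; rewrite exprZn !coefZ coefXn eq_sym.
  have [p1|p1] := ltnP 1 (size p).
    rewrite (bigD1 (Ordinal p1))//= big1 ?addr0 => [|i ne].
      by rewrite mulr1 expr1 mulrC.
    by rewrite (_ : (i == 1%N :> nat) = false) ?mulr0// -(negbTE ne).
  rewrite nth_default// mulr0 big1// => i _.
  by rewrite (_ : (i == 1%N :> nat) = false) ?mulr0//; have := ltn_ord i; lia.
have cabs_real (x : R) : 0 <= x -> cabs x%:C = x.
  by move=> x0; apply: complexI; rewrite -cabsE ger0_norm// lecR.
have cabs_cis (x : R) : cabs (cis x) = 1.
  by rewrite cabs_def /= cos2Dsin2 sqrtr1.
have cabs_i : cabs ('i : CC R) = 1.
  by apply: complexI; rewrite -cabsE normCi.
have hB x : cabs (q.[cis x] * cis x ^- 1 * 'i) <= B.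
  rewrite !cabsM cabs_i cabsV cabsX cabs_cis expr1n invr1 !mulr1 qE.
  by apply: pB; rewrite cabsM cabs_cis mulr1 cabs_real// ltW.
have := has_turn_integral_le (circle_integral_coef q 1) hB.
rewrite !cabsM cabs_i q1 cabsM !cabs_real ?(ltW two_pi_gt0) ?(ltW s0)// mulr1.
rewrite [leRHS]mulrCA ler_pM2l ?two_pi_gt0//.
by rewrite ler_pdivlMr// mulrC.
Qed.

(** The s in ds = i s dx cancels the division by s, so the integral extracts the coefficient of s^(l
    - nu). *)
Lemma tcoefE (l nu mu : rat) (a b c : nat) (Z : HC R) :
  l - nu = a%:R -> l - mu = b%:R -> l + mu = c%:R ->
  tcoef l nu mu Z = (sympoly b c Z)`_a.
Proof.
move=> ha hb hc; rewrite /tcoef hb hc !natrK.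
have -> : - l + nu = (- a%:Z)%:~R by rewrite rmorphN /= -pmulrn -ha; ring.
rewrite intrKfloor.
rewrite /circle_integral.
rewrite (_ : (fun x => _) =
  (fun x => (sympoly b c Z).[cis x] * cis x ^- a * 'i)); last first.
  apply/funext => x.
  have -> : (sympoly b c Z).[cis x] =
      (cis x * Z 0 0 + Z 1 0) ^+ b * (cis x * Z 0 1 + Z 1 1) ^+ c.
    by rewrite /sympoly !hornerE.
  by rewrite exprnN ['i * _]mulrC mulrA divfK ?cis_neq0.
have [_ _ ->] := circle_integral_coef (sympoly b c Z) a.
rewrite mulrA rmorphM rmorph_nat mulVf ?mul1r//.
rewrite !mulf_neq0 ?pnatr_eq0 ?neq0Ci//.
by rewrite -(rmorph0 (real_complex R)) (inj_eq (@complexI R)) gt_eqF ?pi_gt0.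
Qed.

End CircleIntegral.

(** * Polynomial functions and their derivatives *)

Section PolynomialFunctions.
Variable R : realType.
Implicit Types (f g q : HC R -> CC R) (v W E : HC R).

Inductive polyfun : (HC R -> CC R) -> Prop :=
| polyfun_cst (c : CC R) : polyfun (fun=> c)
| polyfun_coord i j : polyfun (fun W => W i j)
| polyfunD f g : polyfun f -> polyfun g -> polyfun (fun W => f W + g W)
| polyfunM f g : polyfun f -> polyfun g -> polyfun (fun W => f W * g W).

Lemma polyfunN f : polyfun f -> polyfun (fun W => - f W).
Proof.
move=> pf; rewrite (_ : (fun W => _) = (fun W => -1 * f W)).
  exact: polyfunM (polyfun_cst _) pf.
by apply/funext => W; rewrite mulN1r.
Qed.

Lemma polyfunB f g : polyfun f -> polyfun g -> polyfun (fun W => f W - g W).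
Proof. by move=> pf /polyfunN; exact: polyfunD. Qed.

Lemma polyfun_sum (I : Type) (s : seq I) (F : I -> HC R -> CC R) :
  (forall i, polyfun (F i)) -> polyfun (fun W => \sum_(i <- s) F i W).
Proof.
move=> pF; elim: s => [|i s IH].
  by under eq_fun do rewrite big_nil; exact: polyfun_cst.
by under eq_fun do rewrite big_cons; exact: polyfunD.
Qed.

Lemma continuous_polyfun f : polyfun f -> continuous f.
Proof.
elim => [c|i j|{}f g _ cf _ cg|{}f g _ cf _ cg] W.
- exact: cst_continuous.
- exact: (@coord_continuous (CC R) 2 2 i j).
- exact: (cvgD (cf W) (cg W)).
- exact: (cvgM (cf W) (cg W)).
Qed.

Lemma is_derive_coord W v i j :
  is_derive W v (fun W' : HC R => W' i j : CC R) (v i j).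
Proof.
have h : (fun h : CC R => h^-1 *: (((fun W' : HC R => W' i j : CC R) \o shift W)
    (h *: v) - W i j)) @ 0^' --> (v i j : CC R).
  apply: cvg_near_cst; rewrite near_withinE; near=> h => h0.
  by rewrite /= !mxE addrK /GRing.scale /= mulKf.
by apply: DeriveDef; [apply/cvg_ex; exists (v i j) | apply/cvg_lim].
Unshelve. all: by end_near.
Qed.

(** One function [g] is both the analytic derivative and the linear coefficient along the line; this
    bridge lets [coef1_le] bound derivatives. *)
Lemma polyfun_line f v : polyfun f -> exists g,
  [/\ polyfun g, forall W, is_derive W v f (g W) &
      forall W, exists2 p : {poly CC R},
        (forall z : CC R, f (W + z *: v) = p.[z]) & p`_1 = g W].
Proof.
elim => [c|i j|{}f1 f2 _ [g1 [pg1 d1 l1]] _ [g2 [pg2 d2 l2]]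
  |{}f1 f2 pf1 [g1 [pg1 d1 l1]] pf2 [g2 [pg2 d2 l2]]].
- exists (fun=> 0); split; first exact: polyfun_cst.
    by move=> W; exact: is_derive_cst.
  by move=> W; exists c%:P => [z|]; rewrite ?hornerC ?coefC.
- exists (fun=> v i j); split; first exact: polyfun_cst.
    by move=> W; exact: is_derive_coord.
  move=> W; exists ((W i j)%:P + v i j *: 'X) => [z|]; rewrite ?hornerE ?mxE 1?mulrC//.
  by rewrite coefD coefC coefZ coefX add0r mulr1.
- exists (fun W => g1 W + g2 W); split; first exact: polyfunD.
    by move=> W; exact: is_deriveD.
  move=> W; have [p1 e1 c1] := l1 W; have [p2 e2 c2] := l2 W.
  by exists (p1 + p2) => [z|]; rewrite ?hornerD ?e1 ?e2// coefD c1 c2.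
- exists (fun W => f1 W * g2 W + f2 W * g1 W); split.
  + by apply: polyfunD; apply: polyfunM.
  + by move=> W; exact: is_deriveM.
  move=> W; have [p1 e1 c1] := l1 W; have [p2 e2 c2] := l2 W.
  have f0 (h : HC R -> CC R) (p : {poly CC R}) :
      (forall z : CC R, h (W + z *: v) = p.[z]) -> p`_0 = h W.
    by move=> e; rewrite -horner_coef0 -e scale0r addr0.
  exists (p1 * p2) => [z|]; first by rewrite hornerM e1 e2.
  rewrite coefM !big_ord_recl big_ord0 /= (f0 _ _ e1) c2 c1 (f0 _ _ e2) addr0.
  by rewrite [g1 W * _]mulrC.
Qed.

Lemma polyfun_is_derive f v W : polyfun f -> is_derive W v f ('D_v f W).
Proof. by move=> /(polyfun_line v)[g [_ d _]]; have [? _] := d W; exact: derivableP. Qed.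

Lemma polyfun_derive f v : polyfun f -> polyfun (fun W => 'D_v f W).
Proof.
move=> /(polyfun_line v)[g [pg d _]]; rewrite (_ : (fun W => _) = g)//.
by apply/funext => W; have [_ ->] := d W.
Qed.

Lemma polyfun_iter_derive vs f : polyfun f -> polyfun (iter_derive vs f).
Proof. by move=> pf; elim: vs => //= v vs; exact: polyfun_derive. Qed.

Lemma iter_derive_sum (I : Type) (s : seq I) (c : I -> CC R)
    (F : I -> HC R -> CC R) vs W : (forall i, polyfun (F i)) ->
  iter_derive vs (fun W' => \sum_(i <- s) c i * F i W') W =
  \sum_(i <- s) c i * iter_derive vs (F i) W.
Proof.
move=> pF; elim: vs W => [//|v vs IH] W /=.
rewrite (_ : iter_derive vs _ = fun W' => \sum_(i <- s) c i * iter_derive vs (F i) W');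
  last exact/funext/IH.
elim: s {IH} => [|i s IHs].
  by under eq_fun do rewrite big_nil; rewrite big_nil derive_cst.
have dF j : is_derive W v (iter_derive vs (F j)) ('D_v (iter_derive vs (F j)) W).
  exact/polyfun_is_derive/polyfun_iter_derive.
under eq_fun do rewrite big_cons.
rewrite big_cons -IHs.
have dS : is_derive W v (fun W' => \sum_(j <- s) c j * iter_derive vs (F j) W')
   ('D_v (fun W' => \sum_(j <- s) c j * iter_derive vs (F j) W') W).
  apply/polyfun_is_derive/polyfun_sum => j.
  by apply: polyfunM; [exact: polyfun_cst | exact: polyfun_iter_derive].
have [_ dE] := is_deriveD (is_deriveZ (c i) (dF i)) dS.
exact: dE.
Qed.

Definition entries_le (rho : R) E := forall i j, cabs (E i j) <= rho.

(** The radius rho is split in two: one half for the displacement [E], the other for the circle of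
    Cauchy's estimate. *)
Lemma polyfun_derive_le f v W (rho B : R) : polyfun f -> entries_le 1 v ->
  0 < rho -> (forall E, entries_le rho E -> cabs (f (W + E)) <= B) ->
  forall E, entries_le (rho / 2) E ->
    cabs ('D_v f (W + E)) <= 2 * B / (rho / 2).
Proof.
move=> pf v1 rho0 fB E EB; have [g [_ d l]] := polyfun_line v pf.
have [_ ->] := d (W + E); have [p pE <-] := l (W + E).
apply: coef1_le; first by rewrite divr_gt0.
move=> z zr; rewrite -pE -addrA; apply: fB => i j; rewrite !mxE.
rewrite [leRHS]splitr; apply: (le_trans (cabsD _ _)); apply: lerD; first exact: EB.
by rewrite cabsM -[leRHS]mulr1 ler_pM ?cabs_ge0.
Qed.

(* The numerator, over q ^+ (size vs).+1, of the iterated derivative of f / q. *)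
Fixpoint quot_num q f vs : HC R -> CC R :=
  if vs is v :: vs' then fun W =>
    'D_v (quot_num q f vs') W * q W
    - (size vs').+1%:R * quot_num q f vs' W * 'D_v q W
  else f.

Lemma polyfun_quot_num q f vs : polyfun q -> polyfun f -> polyfun (quot_num q f vs).
Proof.
move=> pq pf; elim: vs => //= v vs IH; apply: polyfunB.
  by apply: polyfunM => //; exact: polyfun_derive.
apply: polyfunM; last exact: polyfun_derive.
by apply: polyfunM => //; exact: polyfun_cst.
Qed.

Lemma quot_ruleE (F : fieldType) (a x y z k : F) m : a != 0 ->
  x * (- k * y / a ^+ m.+2) + (a ^+ m.+1)^-1 * z =
  (z * a - k * x * y) / a ^+ m.+2.
Proof. by move=> a0; rewrite ![a ^+ _.+1]exprS; field; rewrite expf_neq0. Qed.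

Lemma is_derive_inv_pow q W v k : q W != 0 -> is_derive W v q ('D_v q W) ->
  is_derive W v (fun W' => (q W' ^+ k.+1)^-1)
    (- k.+1%:R * 'D_v q W / q W ^+ k.+2).
Proof.
move=> q0 dq.
have dk : is_derive W v (fun W' => q W' ^+ k.+1) (k.+1%:R * q W ^+ k * 'D_v q W).
  have -> : (fun W' => q W' ^+ k.+1) = q ^+ k.+1 by apply/funext => W'; rewrite exprfctE.
  exact: is_deriveX.
have qk0 : q W ^+ k.+1 != 0 by rewrite expf_neq0.
have [dd de] := dk.
apply: DeriveDef; first exact: (@derivableV _ _ (fun W' => q W' ^+ k.+1)).
have e := @deriveV (CC R) _ (fun W' => q W' ^+ k.+1) W v qk0 dd.
rewrite de in e.
apply: (etrans e).
rewrite /GRing.scale /=.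
set a := q W in q0 qk0 *.
set d := 'D_v q W.
rewrite ![a ^+ _.+1]exprS.
by field; rewrite expf_neq0.
Qed.

(** Meant for g = 1 / q, S a partial sum and f the numerator of its remainder. *)
Lemma iter_derive_quot q f S g vs W : polyfun q -> polyfun f -> polyfun S ->
  (forall W, q W != 0 -> g W = S W + f W / q W) -> q W != 0 ->
  iter_derive vs g W =
  iter_derive vs S W + quot_num q f vs W / q W ^+ (size vs).+1.
Proof.
move=> pq pf pS gE; elim: vs W => [|v vs IH] W q0 /=; first by rewrite gE.
(* The induction hypothesis is available only where q is nonzero; this is a neighbourhood of W,
   which suffices for a derivative at W. *)
have nq : \forall W' \near W, q W' != 0.
  exact: (cvgr_neq0 _ (@continuous_polyfun q pq W) q0).
rewrite (near_eq_derive (g := fun W => iter_derive vs S W +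
   quot_num q f vs W * (q W ^+ (size vs).+1)^-1)); last first.
  by near=> W'; apply: IH; near: W'.
have dS := polyfun_is_derive v W (polyfun_iter_derive vs pS).
have dN := polyfun_is_derive v W (polyfun_quot_num vs pq pf).
have dI := @is_derive_inv_pow q W v (size vs) q0 (polyfun_is_derive v W pq).
have dM := is_deriveM dN dI.
have [_ dE] := is_deriveD dS dM.
apply: (etrans dE); congr (_ + _).
exact: quot_ruleE.
Unshelve. all: by end_near.
Qed.

End PolynomialFunctions.

Lemma ord2 (j : 'I_2) : (j == 0) || (j == 1).
Proof. by case: j => [[|[|]]]. Qed.

(** * Derivatives of the matrix coefficients *)

Section CoefficientDerivatives.
Variable R : realType.
Implicit Types (P Q : HC R -> {poly CC R}) (v W : HC R).

Definition polyfun_coefs P := forall a, polyfun (fun W => (P W)`_a).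

Lemma polyfun_coefsM P Q : polyfun_coefs P -> polyfun_coefs Q ->
  polyfun_coefs (fun W => P W * Q W).
Proof.
move=> hP hQ a; under eq_fun do rewrite coefM.
by apply: polyfun_sum => k; exact: polyfunM.
Qed.

Lemma polyfun_coefs_cst (p : {poly CC R}) : polyfun_coefs (fun=> p).
Proof. by move=> a; exact: polyfun_cst. Qed.

Lemma polyfun_coefs_exp P n : polyfun_coefs P -> polyfun_coefs (fun W => P W ^+ n).
Proof.
move=> hP; elim: n => [|n IH].
  by under eq_fun do rewrite expr0; exact: polyfun_coefs_cst.
by under eq_fun do rewrite exprS; exact: polyfun_coefsM.
Qed.

Definition symlin (i : 'I_2) W : {poly CC R} := 'X * (W 0 i)%:P + (W 1 i)%:P.

Lemma polyfun_coefs_symlin i : polyfun_coefs (symlin i).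
Proof.
move=> a; under eq_fun do rewrite coefD coefXM !coefC.
apply: polyfunD.
  case: (a == 0%N); first exact: polyfun_cst.
  by case: (_ == 0%N); [exact: polyfun_coord | exact: polyfun_cst].
by case: (a == 0%N); [exact: polyfun_coord | exact: polyfun_cst].
Qed.

Lemma polyfun_coefs_sympoly r b c :
  polyfun_coefs (fun W => 'X^r * sympoly b c W).
Proof.
apply: polyfun_coefsM; first exact: polyfun_coefs_cst.
by apply: polyfun_coefsM; apply: polyfun_coefs_exp; exact: polyfun_coefs_symlin.
Qed.

(** Differentiation is coefficientwise, so that the product rule applies to whole polynomials before
    a coefficient is extracted. *)
Definition is_derive_coefs W v P (p : {poly CC R}) :=
  forall a, is_derive W v (fun W' => (P W')`_a : CC R) p`_a.

Lemma is_derive_coefsM W v P Q p q : is_derive_coefs W v P p ->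
  is_derive_coefs W v Q q ->
  is_derive_coefs W v (fun W' => P W' * Q W') (P W * q + Q W * p).
Proof.
move=> dP dQ a.
have dk (k : 'I_a.+1) := is_deriveM (dP k) (dQ (a - k)%N).
have := is_derive_sum dk.
rewrite (_ : \sum_(i < a.+1) _ = (fun W' => (P W' * Q W')`_a)); last first.
  by apply/funext => W'; rewrite fct_sumE coefM.
rewrite (_ : \sum_(i < a.+1) _ = (P W * q + Q W * p)`_a)//.
by rewrite big_split /= coefD [Q W * p]mulrC !coefM; congr (_ + _);
  apply: eq_bigr => k _; rewrite /GRing.scale //= mulrC.
Qed.

Lemma is_derive_coefs_cst W v (p : {poly CC R}) : is_derive_coefs W v (fun=> p) 0.
Proof. by move=> a; rewrite coef0; exact: is_derive_cst. Qed.

Lemma is_derive_coefsX W v P p n : is_derive_coefs W v P p ->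
  is_derive_coefs W v (fun W' => P W' ^+ n) (n%:R * P W ^+ n.-1 * p).
Proof.
move=> dP; elim: n => [|n IH].
  by under eq_fun do rewrite expr0; rewrite !mul0r; exact: is_derive_coefs_cst.
under eq_fun do rewrite exprS.
have := is_derive_coefsM dP IH.
rewrite (_ : P W * _ + _ = n.+1%:R * P W ^+ n * p)//.
case: n {IH} => [|n] /=; first by rewrite !mul0r mulr0 add0r !mul1r.
by rewrite -[n.+2%:R]natr1 exprS; ring.
Qed.

Lemma is_derive_coefs_symlin W j i k :
  is_derive_coefs W (delta_mx j i) (symlin k) ((k == i)%:R * 'X^(j == 0)).
Proof.
move=> a.
have e : is_derive W (delta_mx j i)
    (fun W' : HC R =>
      (if a == 1%N then W' 0 k else if a == 0%N then W' 1 k else 0) : CC R)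
    (if a == 1%N then delta_mx j i 0 k else if a == 0%N then delta_mx j i 1 k else 0).
  case: ifP => _; first exact: is_derive_coord.
  by case: ifP => _; [exact: is_derive_coord | exact: is_derive_cst].
move: e; rewrite (_ : (fun W' => _) = (fun W' => (symlin k W')`_a)); last first.
  apply/funext => W'; rewrite /symlin coefD coefXM !coefC.
  by case: a => [|[|a]] /=; rewrite ?add0r ?addr0.
rewrite (_ : (if _ then _ else _) = ((k == i)%:R * 'X^(j == 0))`_a)//.
rewrite mulr_natl coefMn coefXn !mxE.
case: (k == i); rewrite ?andbF ?mulr0n ?mulr1n ?andbT; last by case: ifP => //; case: ifP.
by case/orP: (ord2 j) => /eqP ->; case: a => [|[|a]].
Qed.

(** The derivative in the entry (j, i) lowers the exponent of column i and brings out X for the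
    first row, 1 for the second. Carrying ['X^r] makes the family stable under iteration. At
    exponent 0 the numerical factor vanishes, so truncated subtraction is harmless. *)
Lemma derive_sympoly (K : CC R) r b c a (j i : 'I_2) W :
  'D_(delta_mx j i) (fun W' => K * ('X^r * sympoly b c W')`_a) W =
  K * (if i == 0 then b else c)%:R *
  ('X^(r + (j == 0)) * sympoly (b - (i == 0)) (c - (i == 1)) W)`_a.
Proof.
have dP n k := is_derive_coefsX n (is_derive_coefs_symlin W j i k).
have d := is_derive_coefsM (is_derive_coefs_cst W (delta_mx j i) 'X^r)
  (is_derive_coefsM (dP b 0) (dP c 1)).
have [_ dE] := is_deriveZ K (d a).
apply: (etrans dE); rewrite -[RHS]mulrA; congr (K * _).
rewrite -coefCM; apply: (congr1 (fun p : {poly CC R} => p`_a)).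
rewrite mulr0 addr0 polyC_natr exprD /sympoly -!/(symlin _ _).
case/orP: (ord2 i) => /eqP -> /=; rewrite ?subn0 ?subn1 mul0r ?(mulr0, add0r, addr0); ring.
Qed.

Lemma iter_derive_sympoly r b c a (s : seq ('I_2 * 'I_2)) :
  iter_derive [seq delta_mx p.1 p.2 | p <- s]
    (fun W => ('X^r * sympoly b c W)`_a) =
  fun W => (b ^_ count (fun p => p.2 == 0) s * c ^_ count (fun p => p.2 == 1) s)%:R *
    ('X^(r + count (fun p => p.1 == 0) s) *
     sympoly (b - count (fun p => p.2 == 0) s) (c - count (fun p => p.2 == 1) s) W)`_a.
Proof.
elim: s => [|[j i] s IH] /=.
  by apply/funext => W; rewrite !ffactn0 !subn0 addn0 mul1r.
apply/funext => W; rewrite IH derive_sympoly -natrM.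
set m := count _ s; set n := count _ s; set t := count _ s.
have ecoef (x y : nat) (p q : {poly CC R}) :
    x = y -> p = q -> x%:R * p`_a = y%:R * q`_a.
  by move=> -> ->.
rewrite -addnA [(t + _)%N]addnC !subnDAC.
by apply: ecoef => //; case/orP: (ord2 i) => /eqP -> /=;
  rewrite ?add0n ?add1n ffactnSr; ring.
Qed.

End CoefficientDerivatives.

(** * Terms of the expansions *)

(** Of the L + n + 1 indices of Sym^(L + n), the derivatives leave L + 1 consecutive ones, starting
    at p; these become the values of nu. *)
Lemma sum_window (V : nmodType) L n p q (h : nat -> V) : n = (p + q)%N ->
  (forall b, (b < p)%N -> h b = 0) -> (forall b, (L + p < b <= L + n)%N -> h b = 0) ->
  \sum_(b < (L + n).+1) h b = \sum_(c < L.+1) h (c + p)%N.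
Proof.
move=> -> h1 h2; rewrite -(big_mkord xpredT h).
have le1 : (p <= (L + (p + q)).+1)%N by lia.
have le2 : (p <= L.+1 + p)%N by lia.
have le3 : (L.+1 + p <= (L + (p + q)).+1)%N by lia.
rewrite (big_cat_nat (leq0n p) le1) (big_cat_nat le2 le3) /=.
rewrite [X in X + _ = _]big_nat big1 => [|b]; last by move=> /andP[_]; exact: h1.
rewrite add0r [X in _ + X = _]big_nat [X in _ + X = _]big1 => [|b]; last first.
  by move=> /andP[hb hb']; apply: h2; lia.
by rewrite addr0 -{1}[p]add0n big_addn addnK big_mkord.
Qed.

Section Expansion.
Variables (R : realType) (n : nat).
Implicit Types (I J : 'I_(2 ^ n)) (Z W : HC R).

Lemma nb1_le I : (nb1 I <= n)%N.
Proof. by rewrite -[X in (_ <= X)%N]card_ord; exact: max_card. Qed.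

Lemma nb12 I : n = (nb1 I + nb2 I)%N.
Proof. by rewrite subnKC ?nb1_le. Qed.

Lemma count_tdigit0 I : count (fun k => tdigit I k == 0) (enum 'I_n) = nb1 I.
Proof.
rewrite -sum1_count big_enum_cond /= sum1dep_card;
apply: eq_card => k; rewrite [LHS]inE.
by apply/idP/idP => [|/set_mem//]; exact: mem_set.
Qed.

Lemma count_tdigit1 I : count (fun k => tdigit I k == 1) (enum 'I_n) = nb2 I.
Proof.
have := count_predC (fun k => tdigit I k == 0) (enum 'I_n).
rewrite count_tdigit0 size_enum_ord [RHS](nb12 I) => /addnI <-.
by apply: eq_count => k /=; case/orP: (ord2 (tdigit I k)) => /eqP ->.
Qed.

Lemma count_seq_pairs (f : 'I_n -> 'I_2 * 'I_2) (P : pred ('I_2 * 'I_2)) :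
  count P [seq f k | k <- enum 'I_n] = count (fun k => P (f k)) (enum 'I_n).
Proof. exact: count_map. Qed.

Lemma iter_derive_digits I J r b c a W :
  iter_derive [seq delta_mx (tdigit J k) (tdigit I k) | k : 'I_n]
    (fun W' => ('X^r * sympoly b c W')`_a) W =
  (b ^_ nb1 I * c ^_ nb2 I)%:R *
    ('X^(r + nb1 J) * sympoly (b - nb1 I) (c - nb2 I) W)`_a.
Proof.
have -> : [seq (delta_mx (tdigit J k) (tdigit I k) : HC R) | k : 'I_n] =
   [seq delta_mx p.1 p.2 | p <- [seq (tdigit J k, tdigit I k) | k <- enum 'I_n]].
  by rewrite -map_comp.
rewrite iter_derive_sympoly !count_seq_pairs -(count_tdigit0 I) -(count_tdigit0 J).
by rewrite -(count_tdigit1 I).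
Qed.

(** All derivatives are in the first row; they bring out X^n, which shifts the coefficient from a +
    n to a. *)
Lemma iter_derive_colF I b c a W :
  iter_derive [seq delta_mx 0 (tdigit I k) | k : 'I_n]
    (fun W' => (sympoly b c W')`_(a + n)) W =
  (b ^_ nb1 I * c ^_ nb2 I)%:R * (sympoly (b - nb1 I) (c - nb2 I) W)`_a.
Proof.
have -> : [seq (delta_mx 0 (tdigit I k) : HC R) | k : 'I_n] =
   [seq delta_mx p.1 p.2 | p <- [seq (0, tdigit I k) | k <- enum 'I_n]].
  by rewrite -map_comp.
rewrite (_ : (fun W' => _) = (fun W' => ('X^0 * sympoly b c W')`_(a + n))); last first.
  by apply/funext => W'; rewrite expr0 mul1r.
rewrite iter_derive_sympoly !count_seq_pairs -(count_tdigit0 I) -(count_tdigit1 I).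
have -> : count (fun=> (0 : 'I_2) == 0) (enum 'I_n) = n.
  by rewrite (@eq_count _ _ predT)// count_predT size_enum_ord.
by rewrite add0n coefXnM ltnNge leq_addl addnK.
Qed.

(** All derivatives are in the first column, so one falling factorial appears; the normalising
    quotient in [rowG] is its inverse. *)
Lemma iter_derive_rowG J b c a W :
  iter_derive [seq delta_mx (tdigit J k) 0 | k : 'I_n]
    (fun W' => (sympoly (b + n) c W')`_a) W =
  ((b + n) ^_ n)%:R * ('X^(nb1 J) * sympoly b c W)`_a.
Proof.
have -> : [seq (delta_mx (tdigit J k) 0 : HC R) | k : 'I_n] =
   [seq delta_mx p.1 p.2 | p <- [seq (tdigit J k, 0) | k <- enum 'I_n]].
  by rewrite -map_comp.
rewrite (_ : (fun W' => _) = (fun W' => ('X^0 * sympoly (b + n) c W')`_a)); last first.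
  by apply/funext => W'; rewrite expr0 mul1r.
rewrite iter_derive_sympoly !count_seq_pairs -(count_tdigit0 J).
have -> : count (fun=> (0 : 'I_2) == 0) (enum 'I_n) = n.
  by rewrite (@eq_count _ _ predT)// count_predT size_enum_ord.
have -> : count (fun=> (0 : 'I_2) == 1) (enum 'I_n) = 0%N.
  by rewrite (@eq_count _ _ pred0)// count_pred0.
by rewrite add0n addnK subn0 ffactn0 muln1.
Qed.

Definition trace_sum M Z W : CC R :=
  (\det Z)^-1 * \sum_(D < M) \tr (sympow D (W *m Z^-1)).

(** Entry (I, J) of the n-fold derivative in W of N(Z)^-1 tr Sym^D(W Z^-1). *)
Definition kernel_term I J D Z W : CC R :=
  \sum_(a < D.+1) \sum_(b < D.+1)
    (\det Z)^-1 * (sympoly a (D - a) Z^-1)`_b *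
    ((b ^_ nb1 I * (D - b) ^_ nb2 I)%:R *
     ('X^(nb1 J) * sympoly (b - nb1 I) (D - b - nb2 I) W)`_a).

Lemma trace_sumE M Z W : trace_sum M Z W =
  \sum_(D < M) \sum_(a < D.+1) \sum_(b < D.+1)
    (\det Z)^-1 * (sympoly a (D - a) Z^-1)`_b * ('X^0 * sympoly b (D - b) W)`_a.
Proof.
rewrite /trace_sum big_distrr; apply: eq_bigr => D _ /=.
rewrite sympowM /mxtrace big_distrr; apply: eq_bigr => a _ /=.
rewrite mxE big_distrr; apply: eq_bigr => b _ /=.
by rewrite !mxE expr0 mul1r; ring.
Qed.

Lemma polyfun_sympoly_term r b c a : polyfun (fun W : HC R => ('X^r * sympoly b c W)`_a).
Proof. exact: polyfun_coefs_sympoly. Qed.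

Lemma iter_derive_trace_sum I J M Z W :
  iter_derive [seq delta_mx (tdigit J k) (tdigit I k) | k : 'I_n] (trace_sum M Z) W =
  \sum_(D < M) kernel_term I J D Z W.
Proof.
have pc := polyfun_cst.
rewrite (_ : trace_sum M Z = fun W => \sum_(D < M) 1 * \sum_(a < D.+1) 1 * \sum_(b < D.+1)
    (\det Z)^-1 * (sympoly a (D - a) Z^-1)`_b * ('X^0 * sympoly b (D - b) W)`_a); last first.
  apply/funext => W'; rewrite trace_sumE; apply: eq_bigr => D _; rewrite mul1r.
  by apply: eq_bigr => a _; rewrite mul1r.
rewrite iter_derive_sum => [|D]; last first.
  apply: polyfun_sum => a; apply: polyfunM; first exact: pc.
  apply: polyfun_sum => b; apply: polyfunM; [exact: pc | exact: polyfun_sympoly_term].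
apply: eq_bigr => D _; rewrite mul1r iter_derive_sum => [|a]; last first.
  apply: polyfun_sum => b; apply: polyfunM; [exact: pc | exact: polyfun_sympoly_term].
apply: eq_bigr => a _; rewrite mul1r iter_derive_sum => [|b]; last exact: polyfun_sympoly_term.
by apply: eq_bigr => b _; rewrite iter_derive_digits.
Qed.

Lemma kernel_term_small I J D Z W : (D < n)%N -> kernel_term I J D Z W = 0.
Proof.
move=> Dn; rewrite /kernel_term big1// => a _; rewrite big1// => b _.
suff -> : (b ^_ nb1 I * (D - b) ^_ nb2 I = 0)%N by rewrite mul0r mulr0.
have := nb12 I; have [h|h] := ltnP b (nb1 I); first by rewrite ffact_small.
by have := ltn_ord b => bD hn; rewrite [X in (_ * X)%N]ffact_small ?muln0//; lia.
Qed.

Lemma sum_kernel_term I J N Z W :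
  \sum_(D < N + n) kernel_term I J D Z W = \sum_(L < N) kernel_term I J (L + n) Z W.
Proof.
rewrite -(big_mkord xpredT (fun D => kernel_term I J D Z W)).
rewrite (big_cat_nat (leq0n n) (leq_addl N n)) /=.
rewrite big_nat big1 => [|D /andP[_]]; last exact: kernel_term_small.
by rewrite add0r -{1}[n]add0n big_addn addnK big_mkord.
Qed.

(** The window is in a, from [nb1 J] on: below it X^(nb1 J) has no coefficient, and above it the
    index exceeds the degree in X, the derived form having degree L. *)
Lemma kernel_termE1 I J L Z W :
  kernel_term I J (L + n) Z W =
  \sum_(b < (L + n).+1) \sum_(c < L.+1)
    (b ^_ nb1 I * (L + n - b) ^_ nb2 I)%:R *
    (sympoly (b - nb1 I) (L + n - b - nb2 I) W)`_c *
    ((\det Z)^-1 * (sympoly (c + nb1 J) (L - c + nb2 J) Z^-1)`_b).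
Proof.
rewrite /kernel_term exchange_big; apply: eq_bigr => b _ /=.
pose h a := (\det Z)^-1 * (sympoly a (L + n - a) Z^-1)`_b *
    ((b ^_ nb1 I * (L + n - b) ^_ nb2 I)%:R *
     ('X^(nb1 J) * sympoly (b - nb1 I) (L + n - b - nb2 I) W)`_a).
have nI := nb12 I; have nJ := nb12 J.
rewrite -/h (eq_bigr (fun a : 'I_(L + n).+1 => h a))//.
rewrite (@sum_window _ L n _ _ h nJ).
- apply: eq_bigr => c _; rewrite /h coefXnM ltnNge leq_addl addnK.
  have -> : (L + n - (c + nb1 J) = L - c + nb2 J)%N by have := ltn_ord c; lia.
  by rewrite /=; ring.
- by move=> a ha; rewrite /h coefXnM ha !mulr0.
(* The two subtracted exponents add up to L only if neither is truncated; otherwise a falling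
   factorial vanishes. *)
move=> a /andP[ha _]; rewrite /h; have [hb|hb] := ltnP b (nb1 I).
  by rewrite ffact_small// mul0n mul0r mulr0.
have [hb'|hb'] := ltnP (L + n - b) (nb2 I).
  by rewrite [X in (_ * X)%N]ffact_small// muln0 mul0r mulr0.
rewrite coefXnM; case: ifP => _; first by rewrite !mulr0.
have lt : ((b - nb1 I) + (L + n - b - nb2 I) < a - nb1 J)%N by have := ltn_ord b; lia.
by rewrite (sympoly_coef0 W lt) !mulr0.
Qed.

(** Here the window is in b, from [nb1 I] on, cut out by the two falling factorials. *)
Lemma kernel_termE2 I J L Z W :
  kernel_term I J (L + n) Z W =
  \sum_(b < (L + n).+1) \sum_(c < L.+1)
    ((c + nb1 I) ^_ nb1 I * (L - c + nb2 I) ^_ nb2 I)%:R *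
    (\det Z)^-1 * (sympoly b (L + n - b) Z^-1)`_(c + nb1 I) *
    ('X^(nb1 J) * sympoly c (L - c) W)`_b.
Proof.
rewrite /kernel_term; apply: eq_bigr => a _ /=.
pose h b := (\det Z)^-1 * (sympoly a (L + n - a) Z^-1)`_b *
    ((b ^_ nb1 I * (L + n - b) ^_ nb2 I)%:R *
     ('X^(nb1 J) * sympoly (b - nb1 I) (L + n - b - nb2 I) W)`_a).
have nI := nb12 I.
rewrite -/h (eq_bigr (fun b : 'I_(L + n).+1 => h b))//.
rewrite (@sum_window _ L n _ _ h nI).
- apply: eq_bigr => c _; rewrite /h addnK.
  have -> : (L + n - (c + nb1 I) = L - c + nb2 I)%N by have := ltn_ord c; lia.
  by rewrite addnK /=; ring.
- by move=> b hb; rewrite /h ffact_small// mul0n mul0r mulr0.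
move=> b /andP[hb hb']; rewrite /h.
by rewrite [X in (_ * X)%N]ffact_small ?muln0 ?mul0r ?mulr0//; lia.
Qed.

End Expansion.

(** * Translation of the half-integer indices *)

Section PartialSums.
Variables (R : realType) (n : nat).
Implicit Types (I J : 'I_(2 ^ n)) (Z W : HC R).

Lemma halfnD a b : halfn (a + b) = halfn a + halfn b.
Proof. by rewrite /halfn natrD mulrDl. Qed.

Lemma halfn2 a : halfn a + halfn a = a%:R.
Proof. by rewrite -mulrDl -[RHS](mulfK (x := 2))//; congr (_ / _); ring. Qed.

(** The natural coordinates are b = l + n/2 - mu and c = l - nu; the pair p, q encodes the shift of
    nu by (q - p)/2. *)
Lemma tcoef_grid L (b c p q : nat) Z : n = (p + q)%N -> (b <= L + n)%N -> (c <= L)%N ->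
  tcoef (halfn L + halfn n) (- halfn L - halfn n + (L + n - b)%:R)
    (- halfn L + (L - c)%:R + (halfn q - halfn p)) Z =
  (sympoly (c + p) (L - c + q) Z)`_b.
Proof.
move=> npq hb hc; apply: tcoefE.
- by rewrite natrB// natrD -!halfn2; ring.
- by rewrite npq halfnD natrB// natrD -!halfn2; ring.
- by rewrite npq halfnD natrD natrB// -!halfn2; ring.
Qed.

Lemma tcoef_grid' L (b c p q : nat) Z : n = (p + q)%N -> (b <= L + n)%N -> (c <= L)%N ->
  tcoef (halfn L + halfn n) (- halfn L + (L - c)%:R + (halfn q - halfn p))
    (- halfn L - halfn n + (L + n - b)%:R) Z =
  (sympoly b (L + n - b) Z)`_(c + p).
Proof.
move=> npq hb hc; apply: tcoefE.
- by rewrite npq halfnD natrB// natrD -!halfn2; ring.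
- by rewrite natrB// natrD -!halfn2; ring.
- by rewrite natrB// natrD -!halfn2; ring.
Qed.

Lemma partial_sumE (a : rat -> rat -> rat -> 'M[CC R]_(2 ^ n)) N I J :
  partial_sum a N I J =
  \sum_(L < N) \sum_(b < (L + n).+1) \sum_(c < L.+1)
    a (halfn L) (- halfn L - halfn n + (L + n - b)%:R) (- halfn L + (L - c)%:R) I J.
Proof.
rewrite /partial_sum summxE; apply: eq_bigr => L _.
rewrite summxE (reindex_inj rev_ord_inj); apply: eq_bigr => b _ /=.
rewrite summxE (reindex_inj rev_ord_inj); apply: eq_bigr => c _ /=.
by rewrite !subSS.
Qed.

Lemma halfn0 : halfn 0 = 0.
Proof. by rewrite /halfn mul0r. Qed.

Lemma partial_sum_colF N I J Z W :
  partial_sum (fun l mu nu => colF n l mu nu W *m rowG' n l mu nu Z) N I J =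
  \sum_(D < N + n) kernel_term I J D Z W.
Proof.
rewrite sum_kernel_term partial_sumE; apply: eq_bigr => L _.
rewrite kernel_termE1; apply: eq_bigr => b _; apply: eq_bigr => c _.
have hb : (b <= L + n)%N by rewrite -ltnS.
have hc : (c <= L)%N by rewrite -ltnS.
rewrite mxE big_ord1 !mxE (tcoef_grid _ (nb12 J))//; congr (_ * _).
rewrite (_ : tcoef _ _ _ = fun W' => (sympoly b (L + n - b) W')`_(c + n)).
  by rewrite iter_derive_colF.
apply/funext => W'.
(* The shift by - n/2 is the case p = n, q = 0. *)
have -> : - halfn L + (L - c)%:R - halfn n = - halfn L + (L - c)%:R + (halfn 0 - halfn n).
  by rewrite halfn0; ring.
exact: (tcoef_grid' W' (esym (addn0 n)) hb hc).
Qed.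

Lemma partial_sum_colF' N I J Z W :
  partial_sum (fun l mu nu => colF' n l mu nu Z *m rowG n l mu nu W) N I J =
  \sum_(D < N + n) kernel_term I J D Z W.
Proof.
rewrite sum_kernel_term partial_sumE; apply: eq_bigr => L _.
rewrite kernel_termE2; apply: eq_bigr => b _; apply: eq_bigr => c _.
have hb : (b <= L + n)%N by rewrite -ltnS.
have hc : (c <= L)%N by rewrite -ltnS.
have e1 : Num.truncn (halfn L - (- halfn L + (L - c)%:R)) = c.
  rewrite -[RHS](@natrK rat); congr Num.truncn.
  by rewrite natrB// -halfn2; ring.
have e2 : Num.truncn (halfn L + (- halfn L + (L - c)%:R)) = (L - c)%N.
  by rewrite -[RHS](@natrK rat); congr Num.truncn; ring.
have fn0 m : (m`!%:R : CC R) != 0 by rewrite pnatr_eq0 -lt0n fact_gt0.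
have ff m k : ((m + k)`!%:R / m`!%:R : CC R) = ((m + k) ^_ k)%:R.
  by rewrite -(@ffact_fact (m + k) k) ?leq_addl// addnK natrM mulfK.
rewrite mxE big_ord1 !mxE e1 e2 !ff (tcoef_grid' _ (nb12 I))//.
rewrite (_ : tcoef _ _ _ = fun W' => (sympoly (c + n) (L - c) W')`_b).
  rewrite iter_derive_rowG -[c`!%:R / _]invf_div ff natrM.
  have K0 : ((c + n) ^_ n)%:R != 0 :> CC R by rewrite -ff mulf_neq0 ?invr_eq0.
  by rewrite mulKf// -!mulrA.
apply/funext => W'.
have -> : - halfn L + (L - c)%:R - halfn n = - halfn L + (L - c)%:R + (halfn 0 - halfn n).
  by rewrite halfn0; ring.
by rewrite (tcoef_grid W' (esym (addn0 n)) hb hc) addn0.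
Qed.

End PartialSums.

(** * Uniform convergence *)

Section UniformBounds.
Variable R : realType.
Implicit Types (Z W E : HC R).

Lemma polyfun_det : polyfun (fun W : HC R => \det W).
Proof.
under eq_fun do rewrite det_mx2.
by apply: polyfunB; apply: polyfunM; exact: polyfun_coord.
Qed.

Lemma det_mulV Z W : \det Z != 0 -> \det (W *m Z^-1) = \det W / \det Z.
Proof.
by move=> Z0; rewrite det_mulmx det_inv.
Qed.

(** This is det(1 - X) = 1 - tr X + det X. It expresses the trace by determinants, whose continuity
    in (Z, W) is at hand. *)
Lemma mxtrace_mulV Z W : \det Z != 0 ->
  \tr (W *m Z^-1) = 1 + \det W / \det Z - \det (Z - W) / \det Z.
Proof.
move=> Z0; have Zu : Z \in unitmx by rewrite unitmxE unitfE.
have -> : Z - W = (1 - W *m Z^-1) *m Z by rewrite mulmxBl mul1mx mulmxKV.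
rewrite det_mulmx mulfK// -det_mulV//; set X := W *m Z^-1.
by rewrite !det_mx2 mxtrace2 !mxE /=; ring.
Qed.

Lemma eigenvalue_sumE Z W (x y : CC R) : \det Z != 0 ->
  \tr (W *m Z^-1) = x + y -> \det (W *m Z^-1) = x * y ->
  \det (Z - W) = \det Z * ((1 - x) * (1 - y)).
Proof.
move=> Z0 tE dE; have := mxtrace_mulV W Z0; rewrite -det_mulV// dE tE => h.
have {}h : \det (Z - W) / \det Z = (1 - x) * (1 - y).
  by rewrite -[LHS](subKr (1 + x * y)) -h; ring.
by rewrite -h mulrCA divff// mulr1.
Qed.

(* The first condition bounds the spectral radius of W Z^-1, x and y running over
   its pairs of eigenvalues. *)
Definition controlled (N : nat) Z W :=
  [/\ forall x y : CC R, \tr (W *m Z^-1) = x + y -> \det (W *m Z^-1) = x * y ->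
        cabs x <= 1 - N.+1%:R^-1,
      cabs (\det (Z - W)) <= N%:R &
      N.+1%:R^-1 <= cabs (\det (Z - W))].

(** A single integer governs all three bounds and may be increased freely, as needed when it runs
    along [\oo] in the covering argument. *)
Lemma controlled_near (ZW : HC R * HC R) : region R ZW ->
  exists N0, \forall p \near (ZW, 0 : HC R), forall N, (N0 <= N)%N ->
    controlled N p.1.1 (p.1.2 + p.2).
Proof.
case: ZW => Z0 W0 [/= dZ0 D0].
have [x0 [y0 [tE dE _ /(_ D0) [x01 y01]]]] := spectrum (W0 *m Z0^-1).
have [r /andP[r0 r1] [e e0 he]] := root_stable x01 y01.
pose q0 := \det (Z0 - W0).
have q00 : q0 != 0.
  rewrite /q0 (eigenvalue_sumE dZ0 tE dE) !mulf_neq0//; rewrite subr_eq0; apply/eqP => h.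
    by move: x01; rewrite -h cabs1 ltxx.
  by move: y01; rewrite -h cabs1 ltxx.
have q0p : 0 < cabs q0 by rewrite cabs_gt0.
(* One summand per bound: r <= 1 - 1/(N + 1), |q| <= 3/2 |q0| <= N, and |q| >= |q0|/2 >= 1/(N +
   1). *)
pose B := (1 - r)^-1 + 2 * cabs q0 + 2 / cabs q0.
have B0 : 0 <= B.
  have h1 : 0 <= (1 - r)^-1 by rewrite invr_ge0 subr_ge0 ltW.
  by rewrite /B; apply: addr_ge0; [apply: addr_ge0 => //|];
    rewrite mulr_ge0 ?invr_ge0 ?cabs_ge0.
exists (Num.bound B).
pose H3 := ((HC R * HC R) * HC R)%type.
pose p0 : H3 := ((Z0, W0), 0).
have cdet (M : HC R) : {for M, continuous (fun W : HC R => \det W : CC R)}.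
  exact: (continuous_polyfun polyfun_det).
have cZ : (fun p : H3 => p.1.1) @ p0 --> Z0.
  apply: (@cvg_comp _ _ _ (@fst (HC R * HC R) (HC R)) (@fst (HC R) (HC R))
    (nbhs p0) (nbhs (Z0, W0))); exact: cvg_fst.
have cW0 : (fun p : H3 => p.1.2) @ p0 --> W0.
  apply: (@cvg_comp _ _ _ (@fst (HC R * HC R) (HC R)) (@snd (HC R) (HC R))
    (nbhs p0) (nbhs (Z0, W0)));
    [exact: cvg_fst | exact: cvg_snd].
have cW : (fun p : H3 => p.1.2 + p.2) @ p0 --> W0.
  by rewrite -[X in _ --> X]addr0; exact: (cvgD cW0 cvg_snd).
have cdZ : (fun p : H3 => \det p.1.1 : CC R) @ p0 --> (\det Z0 : CC R).
  exact: (cvg_comp _ _ cZ (cdet Z0)).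
have cdW : (fun p : H3 => \det (p.1.2 + p.2) : CC R) @ p0 --> (\det W0 : CC R).
  exact: (cvg_comp _ _ cW (cdet W0)).
have cdq : (fun p : H3 => \det (p.1.1 - (p.1.2 + p.2)) : CC R) @ p0 --> (q0 : CC R).
  exact: (cvg_comp _ _ (cvgB cZ cW) (cdet (Z0 - W0))).
have cd : (fun p : H3 => \det (p.1.2 + p.2) / \det p.1.1 : CC R) @ p0
    --> (\det W0 / \det Z0 : CC R).
  exact: (cvgM cdW (cvgV dZ0 cdZ)).
have ct : (fun p : H3 => 1 + \det (p.1.2 + p.2) / \det p.1.1
      - \det (p.1.1 - (p.1.2 + p.2)) / \det p.1.1 : CC R) @ p0
    --> (1 + \det W0 / \det Z0 - q0 / \det Z0 : CC R).
  have c1 : (fun p : H3 => 1 : CC R) @ p0 --> (1 : CC R) by exact: cvg_cst.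
  exact: (cvgB (cvgD c1 cd) (cvgM cdq (cvgV dZ0 cdZ))).
have eC : 0 < (e%:C : CC R) by rewrite ltcR.
have qC : 0 < ((cabs q0 / 2)%:C : CC R) by rewrite ltcR divr_gt0.
move/cvgrPdist_lt : (ct) => /(_ _ eC) nt.
move/cvgrPdist_lt : (cd) => /(_ _ eC) nd.
move/cvgrPdist_lt : (cdq) => /(_ _ qC) nq.
have nZ : \forall p \near p0, \det p.1.1 != 0 :> CC R.
  exact: (cvgr_neq0 _ cdZ dZ0).
have FF : Filter (nbhs p0) := nbhs_filter p0.
apply: (filterS _ (filterI (filterI nt nd) (filterI nq nZ))).
move=> p [[pt' pd'] [pq' pZ]] N hN.
have pt : cabs (1 + \det (p.1.2 + p.2) / \det p.1.1
      - \det (p.1.1 - (p.1.2 + p.2)) / \det p.1.1 - (x0 + y0)) < e.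
  by rewrite -ltcR -cabsE -tE mxtrace_mulV// distrC.
have pd : cabs (\det (p.1.2 + p.2) / \det p.1.1 - x0 * y0) < e.
  by rewrite -ltcR -cabsE -dE det_mulV// distrC.
have pq : cabs (q0 - \det (p.1.1 - (p.1.2 + p.2))) < cabs q0 / 2.
  by rewrite -ltcR -cabsE.
move: pt pd pq; set W := p.1.2 + p.2; set Z := p.1.1; set q := \det (Z - W) => pt pd pq.
have NB : B < N.+1%:R.
  apply: (lt_trans (archi_boundP B0)); rewrite ltr_nat.
  exact: leq_ltn_trans hN _.
have NB' : B <= N%:R.
  by apply: (le_trans (ltW (archi_boundP B0))); rewrite ler_nat.
have [B1 B2 B3] : [/\ (1 - r)^-1 <= B, 2 * cabs q0 <= B & 2 / cabs q0 <= B].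
  have h1 : 0 <= (1 - r)^-1 by rewrite invr_ge0 subr_ge0 ltW.
  have h2 : 0 <= 2 / cabs q0 by rewrite mulr_ge0 ?invr_ge0 ?cabs_ge0.
  by rewrite /B; split; have := cabs_ge0 q0; lra.
split.
- move=> x y xyt xyd; apply: (@le_trans _ _ r).
    apply: (he x y); rewrite -?xyt -?xyd ?mxtrace_mulV ?det_mulV//.
  rewrite lerBrDr -lerBrDl -[leRHS]invrK lef_pV2 ?posrE ?invr_gt0 ?subr_gt0//.
  by apply: (le_trans B1); exact: ltW.
- have := cabsB q0 (q0 - q); rewrite subKr => h; lra.
- have h : cabs q0 / 2 <= cabs q.
    have := cabsD (q0 - q) q; rewrite subrK; lra.
  apply: le_trans h; rewrite -[leRHS]invrK lef_pV2 ?posrE ?invr_gt0 ?divr_gt0//.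
  by rewrite invf_div; apply: (le_trans B3); exact: ltW.
Qed.

Lemma entries_le_nbhs (A : set (HC R)) : nbhs (0 : HC R) A ->
  exists2 rho : R, 0 < rho & forall E, entries_le rho E -> A E.
Proof.
move=> /nbhs_ballP[e /= e0 eA].
have eE : e = (complex.Re e)%:C by rewrite RRe_real// gtr0_real.
have e0' : 0 < complex.Re e by rewrite -ltcR -eE.
exists (complex.Re e / 2); first by rewrite divr_gt0.
move=> E hE; apply: eA; split => // i j.
rewrite /ball /= mxE sub0r normrN cabsE eE ltcR.
apply: le_lt_trans (hE i j) _; lra.
Qed.

(** Compactness in its near-covering form, with (E, N) as the parameter, yields one polydisc and one
    N valid on all of K. *)
Lemma compact_controlled (K : set (HC R * HC R)) : compact K -> K `<=` region R ->
  exists N, exists2 rho : R, 0 < rho &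
    forall Z W, K (Z, W) -> forall E, entries_le rho E -> controlled N Z (W + E).
Proof.
move=> /compact_near_coveringP cK Kr.
pose P (i : HC R * nat) (ZW : HC R * HC R) := controlled i.2 ZW.1 (ZW.2 + i.1).
have := cK (HC R * nat)%type (filter_prod (nbhs (0 : HC R)) \oo) P _.
case=> [ZW KZW|[A B] /= [A0 [N0 _ BN]] AB].
  have [N0 [[A B] /= [nA nB] AB]] := controlled_near (Kr _ KZW).
  exists (A, B `*` [set N | (N0 <= N)%N]) => /=.
    split => //; exists (B, [set N | (N0 <= N)%N]) => //=.
    by split => //; exists N0.
  by move=> [ZW' [E N]] /= [AZ [BE hN]]; apply: (AB (ZW', E)).
have [rho rho0 hrho] := entries_le_nbhs A0.
exists N0, rho => // Z W KZW E hE.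
by apply: (AB (E, N0) _ (Z, W) KZW); split; [exact: hrho | apply: BN => /=].
Qed.

End UniformBounds.

(** * Decay of the remainder and its derivatives *)

Section RemainderDecay.
Variables (R : realType) (K : set (HC R * HC R)).
Implicit Types (Z W E : HC R) (q : HC R -> HC R -> CC R)
  (u : nat -> HC R -> HC R -> CC R).

Definition uniformly_small (rho : R) u :=
  forall e : R, 0 < e -> exists M0, forall M, (M0 <= M)%N ->
    forall Z W, K (Z, W) -> forall E, entries_le rho E -> cabs (u M Z (W + E)) <= e.

Definition uniformly_bounded (rho : R) q :=
  exists2 B : R, 0 < B & forall Z W, K (Z, W) -> forall E, entries_le rho E ->
    cabs (q Z (W + E)) <= B.

Lemma uniformly_small_derive (rho : R) u v : 0 < rho -> entries_le 1 v ->
  (forall M Z, polyfun (u M Z)) -> uniformly_small rho u ->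
  uniformly_small (rho / 2) (fun M Z W => 'D_v (u M Z) W).
Proof.
move=> rho0 v1 pu su e e0.
have [|M0 hM0] := su (e * (rho / 2) / 2); first by rewrite !divr_gt0 ?mulr_gt0 ?divr_gt0.
exists M0 => M /hM0 hM Z W KZW E hE.
apply: (le_trans (polyfun_derive_le (pu M Z) v1 rho0 (hM Z W KZW) hE)).
suff -> : 2 * (e * (rho / 2) / 2) / (rho / 2) = e by [].
by field; rewrite gt_eqF.
Qed.

Lemma uniformly_bounded_derive (rho : R) q v : 0 < rho -> entries_le 1 v ->
  (forall Z, polyfun (q Z)) -> uniformly_bounded rho q ->
  uniformly_bounded (rho / 2) (fun Z W => 'D_v (q Z) W).
Proof.
move=> rho0 v1 pq [B B0 hB]; exists (2 * B / (rho / 2)).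
  by rewrite !divr_gt0 ?mulr_gt0.
by move=> Z W KZW E; apply: polyfun_derive_le => //; exact: hB.
Qed.

Lemma entries_leW (r1 r2 : R) E : r1 <= r2 -> entries_le r1 E -> entries_le r2 E.
Proof. by move=> r12 h i j; exact: le_trans (h i j) r12. Qed.

(** Each step of the recursion adds two products of a small factor, the numerator or its derivative,
    and a bounded one, q or its derivative. Only the radius shrinks. *)
Lemma uniformly_small_quot_num (rho : R) q u vs : 0 < rho ->
  (forall v, v \in vs -> entries_le 1 v) ->
  (forall Z, polyfun (q Z)) -> (forall M Z, polyfun (u M Z)) ->
  uniformly_bounded rho q -> uniformly_small rho u ->
  exists2 rho' : R, 0 < rho' <= rho &
    uniformly_small rho' (fun M Z => quot_num (q Z) (u M Z) vs).
Proof.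
move=> rho0 vs1 pq pu bq su; elim: vs vs1 => [|v vs IH] vs1.
  by exists rho; rewrite ?rho0 /=.
have [|r1 /andP[r10 r1rho] s1] := IH.
  by move=> w wvs; apply: vs1; rewrite inE wvs orbT.
have v1 : entries_le 1 v by apply: vs1; rewrite inE eqxx.
have [B B0 hB] := bq.
have [B' B'0 hB'] := uniformly_bounded_derive rho0 v1 pq bq.
have s2 := uniformly_small_derive r10 v1
  (fun M Z => polyfun_quot_num vs (pq Z) (pu M Z)) s1.
have r12 : 0 < r1 / 2 by rewrite divr_gt0.
exists (r1 / 2).
  by rewrite r12 /=; lra.
move=> e e0; pose k : R := (size vs).+1%:R.
have k0 : 0 < k by rewrite ltr0n.
have [|M1 h1] := s2 (e / 2 / B); first by rewrite !divr_gt0.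
have [|M2 h2] := s1 (e / 2 / (k * B')); first by rewrite !divr_gt0 ?mulr_gt0.
exists (maxn M1 M2) => M; rewrite geq_max => /andP[/h1{}h1 /h2{}h2] Z W KZW E hE /=.
apply: (le_trans (cabsB _ _)); rewrite [leRHS]splitr; apply: lerD; rewrite !cabsM.
  rewrite -[leRHS](divfK (lt0r_neq0 B0)); apply: ler_pM; rewrite ?cabs_ge0//.
    exact: h1.
  by apply: hB => //; apply: entries_leW hE; lra.
rewrite cabs_nat -/k mulrAC.
rewrite -[leRHS](@divfK _ (k * B')) ?mulf_neq0 ?gt_eqF// mulrC.
apply: ler_pM; rewrite ?mulr_ge0 ?cabs_ge0 ?(ltW k0)//.
  by apply: h2 => //; apply: entries_leW hE; lra.
rewrite ler_pM2l//; apply: hB' => //; apply: entries_leW hE; lra.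
Qed.

Lemma polyfun_sympow_trace D (A : HC R) : polyfun (fun W => \tr (sympow D (W *m A))).
Proof.
under eq_fun do rewrite sympowM.
apply: polyfun_sum => a; under eq_fun do rewrite mxE.
apply: polyfun_sum => b; apply: polyfunM; last exact: polyfun_cst.
rewrite (_ : (fun W => _) = (fun W : HC R => ('X^0 * sympoly b (D - b) W)`_a)).
  exact: polyfun_sympoly_term.
by apply/funext => W; rewrite mxE expr0 mul1r.
Qed.

Lemma polyfun_remnum M Z : polyfun (remnum M Z).
Proof.
apply: polyfunB; first exact: polyfun_sympow_trace.
apply: polyfunM; last exact: polyfun_sympow_trace.
under eq_fun do rewrite det_mulmx.
by apply: polyfunM; [exact: polyfun_det | exact: polyfun_cst].
Qed.

Lemma polyfun_trace_sum M Z : polyfun (trace_sum M Z).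
Proof.
apply: polyfunM; first exact: polyfun_cst.
by apply: polyfun_sum => D; exact: polyfun_sympow_trace.
Qed.

Lemma polyfun_det_sub Z : polyfun (fun W : HC R => \det (Z - W)).
Proof.
under eq_fun do rewrite det_mx2 !mxE.
by apply: polyfunB; apply: polyfunM; apply: polyfunB;
  solve [exact: polyfun_cst | exact: polyfun_coord].
Qed.

Lemma uniformly_small_remnum N (rho : R) :
  (forall Z W, K (Z, W) -> forall E, entries_le rho E -> controlled N Z (W + E)) ->
  uniformly_small rho (@remnum R).
Proof.
move=> hc e e0; set r : R := 1 - N.+1%:R^-1.
have N0 : 0 < (N.+1%:R^-1 : R) by rewrite invr_gt0 ltr0n.
have N1 : (N.+1%:R^-1 : R) <= 1 by rewrite invf_le1 ?ler1n ?ltr0n.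
have r01 : 0 <= r < 1 by rewrite /r subr_ge0 N1 ltrBlDr ltrDl.
have [|M0 hM] := nat_geom_cvg0 r01 (e := e / 2); first by rewrite divr_gt0.
exists M0 => M /hM {}hM Z W KZW E hE.
have [h _ _] := hc Z W KZW E hE.
apply: (le_trans (remnum_le _ _ h)); first by case/andP: r01 => -> /ltW.
by move: hM; rewrite -/r; lra.
Qed.

End RemainderDecay.

Section UniformConvergence.
Variables (R : realType) (n : nat) (K : set (HC R * HC R)).
Hypotheses (n1 : (1 <= n)%N) (cK : compact K) (KR : K `<=` region R).

Lemma kernel_entry_cvg (I J : 'I_(2 ^ n)) (e : R) : 0 < e ->
  \forall N \near \oo, forall Z W, K (Z, W) ->
    cabs (ker_half n Z W I J - \sum_(D < N + n) kernel_term I J D Z W) < e.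
Proof.
move=> e0; have [N0 [rho rho0 hc]] := compact_controlled cK KR.
set vs := [seq (delta_mx (tdigit J k) (tdigit I k) : HC R) | k : 'I_n].
have vs1 v : v \in vs -> entries_le (1 : R) v.
  move=> /mapP[k _ ->] i j; rewrite mxE cabs_nat; by case: (_ && _).
have bq : uniformly_bounded K rho (fun Z W => \det (Z - W)).
  exists (N0%:R + 1); first by rewrite ltr_wpDl.
  move=> Z W KZW E hE; have [_ h _] := hc Z W KZW E hE.
  by apply: (le_trans h); rewrite lerDl.
have [rho' /andP[r0 _] sm] := uniformly_small_quot_num rho0 vs1 (@polyfun_det_sub R)
  (@polyfun_remnum R) bq (uniformly_small_remnum hc).
pose dl : R := N0.+1%:R^-1.
have dl0 : 0 < dl by rewrite invr_gt0 ltr0n.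
have ent0 (r : R) : 0 < r -> entries_le r (0 : HC R).
  by move=> r0' i j; rewrite mxE cabs0 ltW.
(* The numerator will be divided by a power of det(Z - W), whose modulus is at least [dl]. *)
have [|M0 hM] := sm (e / 2 * dl ^+ (size vs).+1).
  by rewrite mulr_gt0 ?divr_gt0 ?exprn_gt0.
exists M0 => // N /= hN Z W KZW.
(* The remainder of index M follows the terms D <= M; n >= 1 makes N + n a successor even for N =
   0. *)
have [M eM MM0] : exists2 M, (N + n = M.+1)%N & (M0 <= M)%N.
  by exists (N + n).-1; lia.
have [/= Z0 _] := KR KZW.
have [_ _] := hc Z W KZW 0 (ent0 _ rho0); rewrite addr0 -/dl => qdl.
have q0 : \det (Z - W) != 0 by rewrite -cabs_gt0; exact: lt_le_trans qdl.
rewrite -iter_derive_trace_sum mxE -/vs eM.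
rewrite (@iter_derive_quot R (fun W => \det (Z - W)) (remnum M Z)
  (trace_sum M.+1 Z) _ vs W)//; first last.
- move=> W' q'0; apply: (mulfI q'0); rewrite mulrDr divff// [X in _ + X]mulrCA divff//.
  by rewrite mulr1 /trace_sum resolvent// subrK.
- exact: polyfun_trace_sum.
- exact: polyfun_remnum.
- exact: polyfun_det_sub.
rewrite addrAC subrr add0r cabsM cabsV cabsX.
have := hM M MM0 Z W KZW 0 (ent0 _ r0); rewrite addr0 => h.
apply: (@le_lt_trans _ _ (e / 2)); last by lra.
rewrite ler_pdivrMr ?exprn_gt0 ?cabs_gt0//.
apply: (le_trans h); rewrite ler_pM2l ?divr_gt0//.
by rewrite lerXn2r// nnegrE ltW// (lt_le_trans dl0 qdl).
Qed.

Lemma uniform_cvg_entries (S : nat -> HC R * HC R -> 'M[CC R]_(2 ^ n)) :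
  (forall N I J ZW, S N ZW I J = \sum_(D < N + n) kernel_term I J D ZW.1 ZW.2) ->
  {uniform K, S @ \oo --> (fun ZW : HC R * HC R => ker_half n ZW.1 ZW.2)}.
Proof.
move=> SE P /uniform_nbhs [E [entE EP]].
have [e /= e0 eE] : exists2 e : CC R, 0 < e &
    forall A B : 'M[CC R]_(2 ^ n), (forall i j, `|A i j - B i j| < e) -> E (A, B).
  move: entE; rewrite -entourage_ballE => -[e /= e0 eE].
  by exists e => // A B h; apply: eE; split.
have eR : e = (complex.Re e)%:C by rewrite RRe_real// gtr0_real.
have e0' : 0 < complex.Re e by rewrite -ltcR -eR.
have H : \forall N \near \oo, forall IJ : 'I_(2 ^ n) * 'I_(2 ^ n),
    forall Z W, K (Z, W) ->
    cabs (ker_half n Z W IJ.1 IJ.2 -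
      \sum_(D < N + n) kernel_term IJ.1 IJ.2 D Z W) < complex.Re e.
  (* There are finitely many entries, so one threshold serves them all. *)
  by apply: filter_forall => IJ; exact: kernel_entry_cvg.
apply: filterS H => N hN; apply: EP => -[Z W] KZW; apply: eE => I J.
by rewrite SE cabsE eR ltcR; exact: (hN (I, J)).
Qed.

End UniformConvergence.

Theorem proposition12 (R : realType) (n : nat) (hn : (1 <= n)%N)
    (K : set (HC R * HC R)) (hK : compact K) (hKr : K `<=` region R) :
  {uniform K,
    (fun (N : nat) (ZW : HC R * HC R) =>
       partial_sum
         (fun l mu nu => colF n l mu nu ZW.2 *m rowG' n l mu nu ZW.1) N)
      @ \oo --> (fun ZW : HC R * HC R => ker_half n ZW.1 ZW.2)} /\
  {uniform K,
    (fun (N : nat) (ZW : HC R * HC R) =>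
       partial_sum
         (fun l mu nu => colF' n l mu nu ZW.1 *m rowG n l mu nu ZW.2) N)
      @ \oo --> (fun ZW : HC R * HC R => ker_half n ZW.1 ZW.2)}.
Proof.
split; apply: uniform_cvg_entries => // N I J ZW.
  exact: partial_sum_colF.
exact: partial_sum_colF'.
Qed.
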